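(* Let $\{(X_n,d_n)\}_{n\in\mathbb{Z}}$ be compact metric spaces, $\Lambda_n\subset C_n^+\subset C(X_n)$ ($n\in\mathbb{Z}$) closed convex cones, and fix $\kappa\ge1$, $\Delta>0$, $\tau\in\mathbb{N}$. Let $\mathcal{L}_0$ and $\mathcal{L}_0^+$ be the sets of two-sided and one-sided operator sequences defined in the context, with metrics $d_{\mathcal{L}}$ and $d_{\mathcal{L}^+}$ respectively, and for a sequence $\mathbf{L}$ in one of these sets let $\lambda_n,m_n$ (and, for $\mathbf{L}\in\mathcal{L}_0$, $h_n$) be the associated objects defined in the context. Then: (a) The map $\mathcal{L}_0^+\to(0,\infty)$ taking $\mathbf{L}\mapsto\lambda_0$ is locally Hölder continuous. (b) For all $f\in\Lambda_0$, the map $\mathcal{L}_0^+\to\mathbb{R}$ taking $\mathbf{L}\mapsto\int f\,dm_0$ is locally Hölder continuous. (c) The map $\mathcal{L}_0\to C(X_0)$ taking $\mathbf{L}\mapsto h_0$ is locally Hölder continuous with respect to the uniform norm on $C(X_0)$. By shifting the sequences, it follows that $(\lambda_n,m_n,h_n)$ depend locally Hölder continuously on $\mathbf{L}$ for every $n$ (with Hölder constants depending on $n$).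
   Context: A map between (possibly $[0,\infty]$-valued) metric spaces is locally Hölder continuous if every point of the domain has a neighbourhood on which the map is Hölder continuous for some exponent and constant. A subset $\Lambda\subset\Omega\setminus\{0\}$ of a Banach space $\Omega$ is a convex cone if $t\Lambda=\Lambda$ for all $t>0$ and $f+g\in\Lambda$ for all $f,g\in\Lambda$; it is a closed convex cone if moreover $\Lambda\cup\{0\}$ is norm-closed. Write $f\preceq g$ iff $g-f\in\Lambda\cup\{0\}$, $A(f,g)=\sup\{t>0:tf\preceq g\}$, $B(f,g)=\inf\{t>0:g\preceq tf\}$; the Hilbert projective metric of $\Lambda$ is $\Theta(f,g)=\log\frac{B(f,g)}{A(f,g)}\in[0,\infty]$. $\Theta_n$ is that of $\Lambda_n$. $C(X_n)$ has the sup norm; $C_n^+=\{f\in C(X_n):f\ge0,f\not\equiv0\}$; $\mathbf{1}$ is the constant function $1$. For a sequence of linear operators $L_n\colon C(X_n)\to C(X_{n+1})$, write $\mathbf{L}_n^k=L_{n+k-1}\circ\cdots\circ L_n$. $M(X_n)$ is the set of positive (nonzero) finite Borel measures, $\langle f,m\rangle=\int f\,dm$, and the dual operator $(\mathbf{L}_n^k)^*$ is defined by $\langle f,(\mathbf{L}_n^k)^*m\rangle=\langle\mathbf{L}_n^kf,m\rangle$. Set $\|L\|_{\Lambda_n}=\sup\{\|Lf\|_\infty:f\in\Lambda_n,\|f\|_\infty=1\}$ for linear $L\colon C(X_n)\to C(X_{n+1})$. $\mathcal{L}$ is the space of sequences $\mathbf{L}=\{L_n\colon C(X_n)\to C(X_{n+1})\}_{n\in\mathbb{Z}}$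 of linear operators bounded in these norms, with the $[0,\infty]$-valued metric $d_{\mathcal{L}}(\mathbf{L},\mathbf{L}')=\sum_{n\in\mathbb{Z}}2^{-|n|}\|L_n-L_n'\|_{\Lambda_n}$. $\mathcal{L}_0=\mathcal{L}_0(\kappa,\Delta,\tau)\subset\mathcal{L}$ is the set of $\mathbf{L}$ for which (C1)–(C3) hold with the given cones and the given $\kappa,\Delta,\tau$: (C1) Each $\Lambda_n\subset C(X_n)$ is a closed convex cone with $\mathbf{1}\in\Lambda_n\subset C_n^+$. (C2) Each $L_n$ is a bounded linear operator with $L_n\Lambda_n\subset\Lambda_{n+1}$, and for all $n$: $\kappa^{-1}\le L_n\mathbf{1}(x)\le\kappa$ for all $x\in X_{n+1}$; $\|L_nf\|_\infty\le\kappa\|f\|_\infty$ for all $f\in\Lambda_n$; $\operatorname{diam}_{\Theta_{n+\tau}}\mathbf{L}_n^\tau\Lambda_n\le\Delta$; and $\sup\mathbf{L}_n^\tau\mathbf{1}\le e^\Delta\inf\mathbf{L}_n^\tau\mathbf{1}$. (C3) With $\Lambda_n^p=\{f\in C_n^+:\mathbf{L}_n^pf\in\Lambda_{n+p}\}$ and $\Lambda_n^\infty=\bigcup_{p\ge0}\Lambda_n^p$, the set $\Lambda_n^\infty-\Lambda_n^\infty$ is uniformly dense in $C(X_n)$ for every $n$. $\mathcal{L}^+$, $d_{\mathcal{L}^+}$, $\mathcal{L}_0^+$ are defined similarly using forward sequences $\{L_n\}_{n\ge0}$ (and sums and conditions over $n\ge0$). Definition of $\lambda_n,m_n,h_n$: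 the following limits exist and are independent of the choices of $\sigma_\ell\in M(X_\ell)$ and $f_\ell\in\Lambda_\ell$ (the first two for sequences in $\mathcal{L}_0^+$, $n\ge0$, or $\mathcal{L}_0$, $n\in\mathbb{Z}$; the third for sequences in $\mathcal{L}_0$): $$\lambda_n=\lim_{k\to\infty}\frac{\langle\mathbf{L}_n^k\mathbf{1},\sigma_{n+k}\rangle}{\langle\mathbf{L}_{n+1}^{k-1}\mathbf{1},\sigma_{n+k}\rangle},\quad m_n=\lim_{k\to\infty}\frac{(\mathbf{L}_n^k)^*\sigma_{n+k}}{\langle\mathbf{1},(\mathbf{L}_n^k)^*\sigma_{n+k}\rangle}\ (\text{weak*}),\quad h_n=\lim_{k\to\infty}\frac{\mathbf{L}_{n-k}^kf_{n-k}}{\big(\prod_{j=n-k}^{n-1}\lambda_j\big)\langle f_{n-k},m_{n-k}\rangle}\ (\text{uniformly}).$$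
   Formalization: The sets of admissible operator sequences additionally require that each dual operator maps positive finite Borel measures to positive finite Borel measures (so each L_n preserves nonnegative functions); conditions (C1)–(C3) alone do not imply this, and without it the claim fails. *)

(* Defs.v *)
From HB Require Import structures.
From mathcomp Require Import all_boot all_order all_algebra.
From mathcomp Require Import all_classical all_reals all_analysis.

Set Implicit Arguments.
Unset Strict Implicit.
Unset Printing Implicit Defensive.
Import Order.TTheory GRing.Theory Num.Theory.
Import numFieldNormedType.Exports.
Local Open Scope classical_set_scope.
Local Open Scope ring_scope.

(* The base point is the form in which the library records nonemptiness, which
   it needs to build the Borel sigma-algebra; no generality is lost, since the
   condition that the constant 1 be a nonzero function excludes empty spaces. *)
HB.mixin Record isCompactSpace T & Topological T := {
  space_compact : compact [set: T]
}.

#[short(type="compactMetricType")]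
HB.structure Definition CompactMetric (R : realType) :=
  {T of Metric R T & isPointed T & isCompactSpace T}.

Section continuous_functions.
Context {R : realType}.

Definition cfun (X : compactMetricType R) := continuousType X R.

Variable X : compactMetricType R.

HB.instance Definition _ := Choice.copy (cfun X) (continuousType X R).
Implicit Types f g h : cfun X.

Lemma cfunP f g : (f : X -> R) =1 g -> f = g.
Proof. by move=> fg; apply/continuousEP. Qed.

Lemma cfun_cont f : continuous f.
Proof. exact: cts_fun. Qed.

Lemma cfun0_cont : continuous ((fun=> 0) : X -> R).
Proof. by move=> x; exact: cst_continuous. Qed.
Lemma cfun1_cont : continuous ((fun=> 1) : X -> R).
Proof. by move=> x; exact: cst_continuous. Qed.
Lemma cfunN_cont f : continuous (fun x => - f x).
Proof. by move=> x; apply: cvgN; exact: cfun_cont. Qed.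
Lemma cfunD_cont f g : continuous (fun x => f x + g x).
Proof. by move=> x; apply: cvgD; exact: cfun_cont. Qed.
Lemma cfunZ_cont (a : R) f : continuous (fun x => a * f x).
Proof. by move=> x; apply: cvgM; [exact: cvg_cst|exact: cfun_cont]. Qed.

Definition cfun0 : cfun X := mkcts cfun0_cont.
Definition cfun1 : cfun X := mkcts cfun1_cont.
Definition cfunN f : cfun X := mkcts (@cfunN_cont f).
Definition cfunD f g : cfun X := mkcts (@cfunD_cont f g).
Definition cfunZ a f : cfun X := mkcts (@cfunZ_cont a f).

Let cfun0E x : cfun0 x = 0. Proof. by []. Qed.
Let cfunNE f x : cfunN f x = - f x. Proof. by []. Qed.
Let cfunDE f g x : cfunD f g x = f x + g x. Proof. by []. Qed.
Let cfunZE a f x : cfunZ a f x = a * f x. Proof. by []. Qed.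
Let cfunE := (cfun0E, cfunNE, cfunDE, cfunZE).

Lemma cfunDA : associative cfunD.
Proof. by move=> f g h; apply: cfunP => x; rewrite !cfunE addrA. Qed.
Lemma cfunDC : commutative cfunD.
Proof. by move=> f g; apply: cfunP => x; rewrite !cfunE addrC. Qed.
Lemma cfun0D : left_id cfun0 cfunD.
Proof. by move=> f; apply: cfunP => x; rewrite !cfunE add0r. Qed.
Lemma cfunND : left_inverse cfun0 cfunN cfunD.
Proof. by move=> f; apply: cfunP => x; rewrite !cfunE addNr. Qed.

HB.instance Definition _ :=
  GRing.isZmodule.Build (cfun X) cfunDA cfunDC cfun0D cfunND.

Lemma cfunZA a b f : cfunZ a (cfunZ b f) = cfunZ (a * b) f.
Proof. by apply: cfunP => x; rewrite !cfunE mulrA. Qed.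
Lemma cfun1Z : left_id 1 cfunZ.
Proof. by move=> f; apply: cfunP => x; rewrite !cfunE mul1r. Qed.
Lemma cfunZDr : right_distributive cfunZ +%R.
Proof. by move=> a f g; apply: cfunP => x; rewrite !cfunE mulrDr. Qed.
Lemma cfunZDl f : {morph cfunZ^~ f : a b / a + b}.
Proof. by move=> a b; apply: cfunP => x; rewrite !cfunE mulrDl. Qed.

HB.instance Definition _ :=
  GRing.Zmodule_isLmodule.Build R (cfun X) cfunZA cfun1Z cfunZDr cfunZDl.

Definition supnorm f : R := sup (range (fun x => `|f x|)).

Lemma supnorm_has_sup f : has_sup (range (fun x => `|f x|)).
Proof.
split; first by exists `|f point|, point.
have : compact (range f).
  apply: continuous_compact; last exact: space_compact.
  by apply: continuous_subspaceT; exact: cfun_cont.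
move=> /compact_bounded[M [_ fM]]; exists (M + 1) => _ [x _ <-].
by apply: (fM (M + 1)); [rewrite ltrDl|exists x].
Qed.

Lemma supnorm_ub f x : `|f x| <= supnorm f.
Proof. by apply: sup_upper_bound; [exact: supnorm_has_sup|exists x]. Qed.

Lemma supnorm_le f M : (forall x, `|f x| <= M) -> supnorm f <= M.
Proof.
by move=> fM; apply: ge_sup => [|_ [x _ <-]//]; exists `|f point|, point.
Qed.

Lemma supnormD f g : supnorm (f + g) <= supnorm f + supnorm g.
Proof.
apply: supnorm_le => x; rewrite (le_trans (ler_normD _ _))//.
by rewrite lerD ?supnorm_ub.
Qed.

Lemma supnormZ a f : supnorm (a *: f) = `|a| * supnorm f.
Proof.
have le b g : supnorm (b *: g) <= `|b| * supnorm g.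
  by apply: supnorm_le => x; rewrite normrM ler_wpM2l ?supnorm_ub.
apply/eqP; rewrite eq_le le/=; have [->|a0] := eqVneq a 0.
  by rewrite normr0 mul0r (le_trans _ (supnorm_ub _ point)).
rewrite -ler_pdivlMl ?normr_gt0// -normfV.
by rewrite -[leLHS]/(supnorm f) -[in leLHS](scalerK a0 f) le.
Qed.

Lemma supnorm0_eq0 f : supnorm f = 0 -> f = 0.
Proof.
move=> f0; apply: cfunP => x; apply/eqP; rewrite -normr_le0 -f0.
exact: supnorm_ub.
Qed.

HB.instance Definition _ :=
  Lmodule_isNormed.Build R (cfun X) supnormD supnormZ supnorm0_eq0.

Definition cfun_pos : set (cfun X) :=
  [set f | (forall x, 0 <= f x) /\ f <> 0].

End continuous_functions.
Arguments cfun1 {R X}.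
Arguments cfun_pos {R} X.

Section cones.
Context {R : realType} {V : normedModType R}.
Variable Lam : set V.

Definition convex_cone :=
  [/\ ~ Lam 0,
      forall t : R, 0 < t -> [set t *: f | f in Lam] = Lam &
      forall f g, Lam f -> Lam g -> Lam (f + g)].

Definition closed_convex_cone := convex_cone /\ closed (Lam `|` [set 0]).

Definition cone_le (f g : V) := (Lam `|` [set 0]) (g - f).

(* The supremum is taken in [0, +oo]: 0 is the supremum of the empty set. *)
Definition hilbertA (f g : V) : \bar R :=
  ereal_sup ([set 0%E] `|` [set t%:E | t in [set t | 0 < t /\ cone_le (t *: f) g]]).

Definition hilbertB (f g : V) : \bar R :=
  ereal_inf [set t%:E | t in [set t | 0 < t /\ cone_le g (t *: f)]].

(* In the library 0^-1 = +oo on extended reals, so this is +oo as soon as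
   hilbertA f g = 0 or hilbertB f g = +oo. *)
Definition hilbert_metric (f g : V) : \bar R :=
  lne (hilbertB f g / hilbertA f g)%E.

Definition hilbert_diam (S : set V) : \bar R :=
  ereal_sup [set hilbert_metric p.1 p.2 | p in S `*` S].

End cones.

Section borel_measures.
Context {R : realType}.

Definition borel (X : compactMetricType R) :=
  g_sigma_algebraType (@open X).

Definition borel_measure (X : compactMetricType R) :=
  {measure set (borel X) -> \bar R}.

HB.instance Definition _ X := gen_eqMixin (borel_measure X).
HB.instance Definition _ X := gen_choiceMixin (borel_measure X).

Definition fin_pos_measure (X : compactMetricType R) : set (borel_measure X) :=
  [set m | (0 < m setT < +oo)%E].

Definition pairing (X : compactMetricType R) (f : cfun X)
  (m : borel_measure X) : R := Rintegral m setT (f : borel X -> R).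

(* The dual of A at the measure m, as the functional f |-> <A f, m>. *)
Definition dual (X Y : compactMetricType R) (A : cfun X -> cfun Y)
  (m : borel_measure Y) : cfun X -> R := fun f => pairing (A f) m.

(* That the dual of A is an operator from M(Y) to M(X) amounts to A preserving
   nonnegative functions, together with A 1 > 0 everywhere; mapping a cone of
   nonnegative functions into another one does not imply it. *)
Definition dual_on_measures (X Y : compactMetricType R)
  (A : cfun X -> cfun Y) :=
  forall m : borel_measure Y, fin_pos_measure m ->
    exists2 m' : borel_measure X, fin_pos_measure m' &
      forall f, pairing f m' = dual A m f.

Definition weak_star_cvg (X : compactMetricType R) (phi : nat -> cfun X -> R)
  (m : borel_measure X) :=
  forall f : cfun X, phi k f @[k --> \oo] --> pairing f m.

End borel_measures.

(* The maps are considered on the subset D of T only; d is [0, +oo]-valued. *)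
Definition locally_holder {R : realType} {T : Type} {V : normedZmodType R}
    (D : set T) (d : T -> T -> \bar R) (F : T -> V) :=
  forall x, D x -> exists r C a : R,
    [/\ 0 < r, 0 <= C, 0 < a <= 1 &
     forall y z, D y -> D z -> (d x y < r%:E)%E -> (d x z < r%:E)%E ->
       (`|F y - F z|%:E <= C%:E * (d y z `^ a))%E].

Unset Implicit Arguments.

Section operator_sequences.
Context {R : realType}.

Definition opnorm {X Y : compactMetricType R} (Lam : set (cfun X))
  (A : cfun X -> cfun Y) : \bar R :=
  ereal_sup [set `|A f|%:E | f in [set f | Lam f /\ `|f| = 1]].

(* Sequences are indexed by an abstract type I with a successor map and a
   modulus, to be instantiated with int (two-sided) and nat (one-sided). *)
Variables (I : choiceType) (succ : I -> I) (modulus : I -> nat).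
Variable X : I -> compactMetricType R.
Variable Lam : forall n, set (cfun (X n)).

Definition opseq := forall n, {linear cfun (X n) -> cfun (X (succ n))}.

(* advance k n is n + k, in the form that makes opprod typecheck *)
Fixpoint advance (k : nat) (n : I) : I :=
  if k is k'.+1 then advance k' (succ n) else n.

(* the product L_(n+k-1) \o ... \o L_n *)
Fixpoint opprod (L : opseq) (k : nat) (n : I) :
    cfun (X n) -> cfun (X (advance k n)) :=
  match k return cfun (X n) -> cfun (X (advance k n)) with
  | 0%N => id
  | k'.+1 => fun f => opprod L k' (succ n) (L n f)
  end.

Definition opdist (L L' : opseq) : \bar R :=
  (\esum_(n in [set: I])
    ((2 ^- modulus n)%:E * opnorm (Lam n) (fun f => L n f - L' n f)%R))%E.

Definition cone_bounded (L : opseq) :=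
  forall n, (opnorm (Lam n) (L n) < +oo)%E.

Variables (kappa Delta : R) (tau : nat).

Definition C1 := forall n,
  [/\ closed_convex_cone (Lam n), Lam n cfun1 & Lam n `<=` cfun_pos (X n)].

Definition C2 (L : opseq) := forall n,
  (exists M : R, forall f, `|L n f| <= M * `|f|) /\
  [/\ L n @` Lam n `<=` Lam (succ n),
      forall x, kappa^-1 <= L n cfun1 x <= kappa,
      forall f, Lam n f -> `|L n f| <= kappa * `|f|,
      (hilbert_diam (Lam (advance tau n)) (opprod L tau n @` Lam n)
        <= Delta%:E)%E &
      sup (range (opprod L tau n cfun1)) <=
        expR Delta * inf (range (opprod L tau n cfun1))].

Definition cone_pre (L : opseq) (p : nat) (n : I) : set (cfun (X n)) :=
  [set f | cfun_pos (X n) f /\ Lam (advance p n) (opprod L p n f)].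

Definition cone_preoo (L : opseq) (n : I) : set (cfun (X n)) :=
  \bigcup_p cone_pre L p n.

Definition C3 (L : opseq) := forall n,
  dense [set p.1 - p.2 | p in cone_preoo L n `*` cone_preoo L n].

Definition admissible : set opseq :=
  [set L | [/\ cone_bounded L, forall n, dual_on_measures (L n),
                C1, C2 L & C3 L]].

Definition test_measures (sigma : forall n, borel_measure (X n)) :=
  forall n, fin_pos_measure (sigma n).

(* The quotient for k.+1 operators: the numerator starts at n, the denominator
   at n + 1, and both are tested against the same measure at n + k + 1. *)
Definition is_lambda (L : opseq) (n : I) (l : R) :=
  forall sigma, test_measures sigma ->
    pairing (opprod L k.+1 n cfun1) (sigma (advance k.+1 n)) /
    pairing (opprod L k (succ n) cfun1) (sigma (advance k.+1 n))
    @[k --> \oo] --> l.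

Definition is_m (L : opseq) (n : I) (m : borel_measure (X n)) :=
  fin_pos_measure m /\
  forall sigma, test_measures sigma ->
    weak_star_cvg (fun k f =>
      dual (opprod L k n) (sigma (advance k n)) f /
      dual (opprod L k n) (sigma (advance k n)) cfun1) m.

(* By is_lambda, is_m and is_h below, the values picked here are the limits
   common to all choices; the default is only used when there is no limit. *)
Definition lim_lambda (L : opseq) (n : I) : R := xget 0 [set l | is_lambda L n l].

Definition lim_m (L : opseq) (n : I) : borel_measure (X n) :=
  xget (mzero : borel_measure (X n)) [set mu | is_m L n mu].

End operator_sequences.
Arguments advance {I} succ k n.
Arguments opseq {R I} succ X.
Arguments opprod {R I succ X} L k n f.
Arguments opdist {R I succ} modulus {X} Lam L L'.
Arguments cone_bounded {R I succ X} Lam L.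
Arguments C1 {R I X} Lam.
Arguments C2 {R I succ X} Lam kappa Delta tau L.
Arguments cone_pre {R I succ X} Lam L p n.
Arguments cone_preoo {R I succ X} Lam L n.
Arguments C3 {R I succ X} Lam L.
Arguments admissible {R I succ X} Lam kappa Delta tau L.
Arguments test_measures {R I X} sigma.
Arguments is_lambda {R I succ X} L n l.
Arguments is_m {R I succ X} L n m.
Arguments lim_lambda {R I succ X} L n.
Arguments lim_m {R I succ X} L n.

Section two_sided.
Context {R : realType}.

Definition int_succ (n : int) : int := n + 1.

Lemma advance_int k (n : int) : advance int_succ k n = n + k%:Z.
Proof.
by elim: k n => [|k IH] n /=; rewrite ?addr0// IH /int_succ -addrA -intS.
Qed.

Lemma advance_nat k (n : nat) : advance S k n = (n + k)%N.
Proof. by elim: k n => [|k IH] n /=; rewrite ?addn0// IH addSnnS. Qed.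

Lemma advance_subK k (n : int) : advance int_succ k (n - k%:Z) = n.
Proof. by rewrite advance_int subrK. Qed.

Variable X : int -> compactMetricType R.
Variable Lam : forall n, set (cfun (X n)).

Definition cfun_cast {i j : int} (e : i = j) (f : cfun (X i)) : cfun (X j) :=
  ecast n (cfun (X n)) e f.

Definition is_h (L : opseq int_succ X) (n : int) (h : cfun (X n)) :=
  forall f : (forall l, cfun (X l)), (forall l, Lam l (f l)) ->
    (\prod_(1 <= j < k.+1) lim_lambda L (n - j%:Z) *
       pairing (f (n - k%:Z)) (lim_m L (n - k%:Z)))^-1 *:
      cfun_cast (advance_subK k n) (opprod L k (n - k%:Z) (f (n - k%:Z)))
    @[k --> \oo] --> h.

Definition lim_h (L : opseq int_succ X) (n : int) : cfun (X n) :=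
  xget 0 [set g | is_h L n g].

End two_sided.
Arguments is_h {R X} Lam L n h.
Arguments lim_h {R X} Lam L n.

Section spaces_of_sequences.
Context {R : realType}.
Variable X : int -> compactMetricType R.
Variable Lam : forall n, set (cfun (X n)).
Variables (kappa Delta : R) (tau : nat).

Definition spaces_fwd (n : nat) : compactMetricType R := X n%:Z.
Definition cones_fwd (n : nat) : 
    set (cfun (spaces_fwd n)) := Lam n%:Z.

Definition seq2 := opseq int_succ X.
Definition dist2 : seq2 -> seq2 -> \bar R := opdist absz Lam.
Definition L0 : set seq2 := admissible Lam kappa Delta tau.

Definition seq1 := opseq S spaces_fwd.
Definition dist1 : seq1 -> seq1 -> \bar R := opdist id cones_fwd.
Definition L0plus : set seq1 := admissible cones_fwd kappa Delta tau.

End spaces_of_sequences.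
Arguments cones_fwd {R X} Lam n.
Arguments dist2 {R X} Lam L L'.
Arguments dist1 {R X} Lam L L'.
Arguments L0 {R X} Lam kappa Delta tau L.
Arguments L0plus {R X} Lam kappa Delta tau L.

(* Main.v *)
Require Import Defs.
From HB Require Import structures.
From mathcomp Require Import all_boot all_order all_algebra.
From mathcomp Require Import all_classical all_reals all_analysis.
From mathcomp Require Import measurable_realfun ring lra zify.

Import Order.TTheory GRing.Theory Num.Theory.
Import numFieldNormedType.Exports.
Local Open Scope classical_set_scope.
Local Open Scope ring_scope.

Set Implicit Arguments.
Unset Strict Implicit.
Unset Printing Implicit Defensive.

(** Write L^k for a product of k consecutive operators and m(f) for the integral
    of f. The theorem rests on a contraction estimate that is uniform over all
    admissible sequences, and on a crude Lipschitz estimate for finite products.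

    Contraction. Suppose a g <= f <= b g in the order of a cone. The slacks
    f - a g and b g - f lie in the closed cone and add up to (b - a) g. A block
    of tau + 1 operators maps the cone into a set of finite projective diameter,
    so after a block each slack is comparable to the image of g up to a factor
    D = 2 exp(Delta); hence a and b can be brought closer by a factor
    1 - 1/D ([block_contract]). Iterating, any two elements f, g of a cone satisfy
    a L^k g <= L^k f <= b L^k g with b/a - 1 exponentially small in k
    ([projective_squeeze]).

    Limits. All quotients <L^k f, s> / <L^k 1, s> lie in the shrinking interval
    [a, b] whatever s is, so they have a common limit when f ends up in a cone;
    by (C3), linearity and density this holds for every continuous f. The limit
    is a positive normalized functional, hence a measure m_n by the Riesz
    representation theorem ([riesz], [lim_mP]). Then lambda_n = m_(n+1)(L_n 1) and
    m_(n+1)(L_n f) = lambda_n m_n(f), so that the functions whose limit is h_n are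
    exactly the w / m_n(w) for w = L^k f coming from k steps in the past. Two such
    functions are nearly proportional and have the same integral, so they are
    close in the uniform norm ([normalized_close]) and h_n exists ([lim_hP]).

    Dependence on L. The duals map measures to measures, so every L_n preserves
    nonnegativity and has norm at most kappa on all of C(X_n). Telescoping then
    shows that products of k operators at distance d differ by at most
    const (4 kappa)^k d on the unit ball of the cone ([opprod_close]). The limits
    differ from quantities built from k operators by O(t^k), uniformly in L, and
    those quantities change by O(M^k d). Choosing k so that M^k d is comparable
    to t^k gives a bound by a power of d ([locally_holder_of_scales]). This is
    applied to m_n ([lim_m_scale]), then to lambda_n, then to h_n, for which
    L^k 1 / m_n(L^k 1) is the approximation ([lim_h_scale]). *)

(** * Continuous functions and their integrals *)

Section continuous_function_order.
Context {R : realType} {X : compactMetricType R}.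
Implicit Types f g : cfun X.

Lemma cfunDE f g x : (f + g) x = f x + g x. Proof. by []. Qed.
Lemma cfunNE f x : (- f) x = - f x. Proof. by []. Qed.
Lemma cfunBE f g x : (f - g) x = f x - g x. Proof. by []. Qed.
Lemma cfunZE (a : R) f x : (a *: f) x = a * f x. Proof. by []. Qed.
Lemma cfun0E x : (0 : cfun X) x = 0. Proof. by []. Qed.
Lemma cfun1E x : (cfun1 : cfun X) x = 1. Proof. by []. Qed.
Definition cfunE := (cfunDE, cfunNE, cfunZE, cfun0E, cfun1E).

Lemma cfun_norm_ub f x : `|f x| <= `|f|.
Proof. exact: supnorm_ub. Qed.

Lemma cfun_norm_le f M : (forall x, `|f x| <= M) -> `|f| <= M.
Proof. exact: supnorm_le. Qed.

Lemma cfun_min_cont f g : continuous (fun x => Num.min (f x) (g x)).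
Proof. by move=> x; apply: continuous_min; exact: cfun_cont. Qed.

Definition cfun_min f g : cfun X := mkcts (@cfun_min_cont f g).

Definition cfun_ge0 f := forall x, 0 <= f x.

End continuous_function_order.

Section pairing_theory.
Context {R : realType} {X : compactMetricType R}.
Implicit Types (f g : cfun X) (m : borel_measure X).

Lemma open_borel (U : set X) : open U -> measurable (U : set (borel X)).
Proof. exact: sub_sigma_algebra. Qed.

Lemma cfun_measurable f : measurable_fun [set: borel X] (f : borel X -> R).
Proof.
apply: (measurability _ (RGenOpens.measurableE R)).
move=> _ [_ [a [b ->] <-]]; rewrite setTI.
by apply: open_borel; have /continuousP := @cfun_cont _ _ f; apply; exact: interval_open.
Qed.

Lemma cfun_integrable m f : fin_pos_measure m ->
  m.-integrable [set: borel X] (EFin \o (f : borel X -> R)).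
Proof.
move=> /andP[_ mfin]; apply: measurable_bounded_integrable => //.
  exact: cfun_measurable.
exists `|f|; split; first exact: num_real.
by move=> M fM x _; apply: le_trans (cfun_norm_ub f x) (ltW fM).
Qed.

Lemma pairingD m f g : fin_pos_measure m ->
  pairing (f + g) m = pairing f m + pairing g m.
Proof. by move=> mP; rewrite /pairing -RintegralD//; exact: cfun_integrable. Qed.

Lemma pairingZ m a f : fin_pos_measure m ->
  pairing (a *: f) m = a * pairing f m.
Proof. by move=> mP; rewrite /pairing -RintegralZl//; exact: cfun_integrable. Qed.

Lemma pairingB m f g : fin_pos_measure m ->
  pairing (f - g) m = pairing f m - pairing g m.
Proof. by move=> mP; rewrite pairingD// -scaleN1r pairingZ// mulN1r. Qed.

Lemma pairing_le m f g : fin_pos_measure m -> (forall x, f x <= g x) ->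
  pairing f m <= pairing g m.
Proof. by move=> mP fg; apply: le_Rintegral => //; exact: cfun_integrable. Qed.

Lemma pairing1 m : pairing (cfun1 : cfun X) m = fine (m setT).
Proof. by rewrite /pairing [LHS]Rintegral_cst// mul1r. Qed.

Lemma pairing1_gt0 m : fin_pos_measure m -> 0 < pairing (cfun1 : cfun X) m.
Proof. by move=> mP; rewrite pairing1 fine_gt0. Qed.

Definition point_mass (x : X) : borel_measure X := (\d_(x : borel X))%R.

Lemma point_mass_fin_pos x : fin_pos_measure (point_mass x).
Proof. by rewrite /fin_pos_measure /point_mass /= diracT lte01 ltry. Qed.

Lemma pairing_point_mass f x : pairing f (point_mass x) = f x.
Proof.
rewrite /pairing /Rintegral integral_dirac//; first by rewrite diracT mul1e.
by apply/measurable_EFinP; exact: cfun_measurable.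
Qed.

End pairing_theory.

(** * The Riesz representation theorem on a compact metric space *)

Section depth.
Context {R : realType} {X : compactMetricType R}.
Implicit Types (U : set X) (x y : X).

(** The distance to the complement of U, truncated at 1 so that it makes sense
    when U is the whole space. It is continuous and, for open U, positive exactly
    on U. *)
Definition depth U x : R := inf ([set 1] `|` [set mdist x y | y in ~` U]).

Let depth_has_inf U x : has_inf ([set 1] `|` [set mdist x y | y in ~` U]).
Proof.
split; first by exists 1; left.
by exists 0 => _ [->//|[y _ <-]]; exact: mdist_ge0.
Qed.

Lemma depth_ge U x M : M <= 1 -> (forall y, ~ U y -> M <= mdist x y) ->
  M <= depth U x.
Proof.
move=> M1 My; apply: lb_le_inf; first by exists 1; left.
by move=> _ [->//|[y Uy <-]]; exact: My.
Qed.

Lemma depth_le1 U x : depth U x <= 1.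
Proof. by apply: ge_inf; [have [] := depth_has_inf U x|left]. Qed.

Lemma depth_le U x y : ~ U y -> depth U x <= mdist x y.
Proof.
by move=> Uy; apply: ge_inf; [have [] := depth_has_inf U x|right; exists y].
Qed.

Lemma depth_ge0 U x : 0 <= depth U x.
Proof. by apply: depth_ge => // y _; exact: mdist_ge0. Qed.

Lemma depth_eq0 U x : ~ U x -> depth U x = 0.
Proof.
by move=> Ux; apply/eqP; rewrite eq_le depth_ge0 andbT -(mdistxx x) depth_le.
Qed.

Lemma depth_gt0 U x : open U -> U x -> 0 < depth U x.
Proof.
move=> oU Ux; have /nbhs_ballP[e /= e0 eU] : nbhs x U by exact: open_nbhs_nbhs.
apply: (@lt_le_trans _ _ (Num.min 1 e)); first by rewrite lt_min ltr01.
apply: depth_ge => [|y Uy]; first by rewrite ge_min lexx.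
rewrite ge_min; apply/orP; right; rewrite leNgt; apply/negP => xy.
by apply/Uy/eU; rewrite ballEmdist.
Qed.

Lemma depth_lipschitz U x y : depth U x <= mdist x y + depth U y.
Proof.
rewrite -lerBlDl; apply: depth_ge => [|z Uz].
  by rewrite lerBlDr (le_trans (depth_le1 U x))// lerDl mdist_ge0.
by rewrite lerBlDl (le_trans (depth_le x Uz))// metric_triangle.
Qed.

Lemma depth_cont U : continuous (depth U).
Proof.
move=> x; apply/cvgrPdist_lt => e e0; near=> y.
have xy : mdist x y < e.
  near: y; have := nbhsx_ballx x e e0; rewrite ballEmdist => h.
  exact: filterS h.
apply: le_lt_trans xy; rewrite ler_norml; apply/andP; split.
  by rewrite lerNl opprB lerBlDr metric_sym depth_lipschitz.
by rewrite lerBlDr depth_lipschitz.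
Unshelve. all: by end_near. Qed.

End depth.

Section riesz.
Context {R : realType} {X : compactMetricType R}.
Variable phi : cfun X -> R.
Hypothesis phiD : forall f g, phi (f + g) = phi f + phi g.
Hypothesis phiZ : forall a f, phi (a *: f) = a * phi f.
Hypothesis phi_ge0 : forall f, cfun_ge0 f -> 0 <= phi f.
Hypothesis phi1 : phi cfun1 = 1.
Implicit Types (f g : cfun X) (U A : set X).

Let phi_le f g : (forall x, f x <= g x) -> phi f <= phi g.
Proof.
move=> fg; rewrite -subr_ge0 -mulN1r -phiZ -phiD phi_ge0// => x.
by rewrite !cfunE mulN1r subr_ge0.
Qed.

Let phiB f g : phi (f - g) = phi f - phi g.
Proof. by rewrite -scaleN1r phiD phiZ mulN1r. Qed.

Let phi0 : phi 0 = 0.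
Proof. by have := phiZ 0 0; rewrite scale0r mul0r. Qed.

Let below U : set (cfun X) :=
  [set f | forall x, 0 <= f x <= 1 /\ (~ U x -> f x = 0)].

Let below_le1 U f : below U f -> phi f <= 1.
Proof. by move=> fU; rewrite -phi1; apply: phi_le => x; have [/andP[]] := fU x. Qed.

Let below0 U : below U 0.
Proof. by move=> x; rewrite cfunE lexx ler01. Qed.

(** The measure of an open set is to be the supremum of phi over the functions
    below its indicator; the measure itself is the induced outer measure,
    restricted to the Borel sets. *)
Let content U : R := sup [set phi f | f in below U].

Let phi_le_content U f : below U f -> phi f <= content U.
Proof.
move=> fU; apply: ub_le_sup; last by exists f.
by exists 1 => _ [g gU <-]; exact: below_le1 gU.
Qed.

Let content_le U M : (forall f, below U f -> phi f <= M) -> content U <= M.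
Proof.
move=> fM; apply: ge_sup; first by exists (phi 0); exists 0.
by move=> _ [f fU <-]; exact: fM.
Qed.

Let content_ge0 U : 0 <= content U.
Proof. by rewrite -phi0; apply: phi_le_content. Qed.

Let content_le1 U : content U <= 1.
Proof. by apply: content_le => f; exact: below_le1. Qed.

Let contentS U V : U `<=` V -> content U <= content V.
Proof.
move=> UV; apply: content_le => f fU; apply: phi_le_content => x.
by have [f01 f0] := fU x; split=> // nV; apply: f0 => /UV.
Qed.

Let outer A : R := inf [set content U | U in [set U | open U /\ A `<=` U]].

Let outer_le A U : open U -> A `<=` U -> outer A <= content U.
Proof.
move=> oU AU; apply: ge_inf; last by exists U.
by exists 0 => _ [V _ <-]; exact: content_ge0.
Qed.

Let outer_ge A M : (forall U, open U -> A `<=` U -> M <= content U) ->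
  M <= outer A.
Proof.
move=> MU; apply: lb_le_inf; last by move=> _ [U [oU AU] <-]; exact: MU.
by exists (content setT), setT => //; split => //; exact: openT.
Qed.

Let outer_open U : open U -> outer U = content U.
Proof.
move=> oU; apply/eqP; rewrite eq_le outer_le//=.
by apply: outer_ge => V _ UV; exact: contentS.
Qed.

Let outer_ge0 A : 0 <= outer A.
Proof. by apply: outer_ge => U _ _; exact: content_ge0. Qed.

Let outerS A B : A `<=` B -> outer A <= outer B.
Proof.
move=> AB; apply: outer_ge => U oU BU; apply: outer_le => //.
exact: subset_trans BU.
Qed.

Let outer0 : outer set0 = 0.
Proof.
apply/eqP; rewrite eq_le outer_ge0 andbT outer_open; last exact: open0.
apply: content_le => f f0; rewrite -phi0; apply: phi_le => x.
by have [_ ->] := f0 x.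
Qed.

Let bump_cont U (k : nat) : continuous (fun x => Num.min 1 (k%:R * depth U x)).
Proof.
move=> x; apply: (@continuous_min R X (fun=> 1)); first exact: cvg_cst.
by apply: cvgM; [exact: cvg_cst|exact: depth_cont].
Qed.

(** As k grows these increase to the indicator of U. *)
Let bump U k : cfun X := mkcts (@bump_cont U k).

Let bumpE U k x : bump U k x = Num.min 1 (k%:R * depth U x).
Proof. by []. Qed.

Let bump_below U k : below U (bump U k).
Proof.
move=> x; rewrite !bumpE; split.
  by rewrite le_min ler01 ge_min lexx mulr_ge0 ?depth_ge0//=.
by move=> nUx; rewrite (depth_eq0 nUx) mulr0; apply/min_idPr.
Qed.

Let bump_eventually1 U x : open U -> U x ->
  exists k0, forall k, (k0 <= k)%N -> bump U k x = 1.
Proof.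
move=> oU Ux; have d0 := depth_gt0 oU Ux.
exists (Num.truncn (depth U x)^-1).+1 => k k0k.
rewrite bumpE; apply/min_idPl.
rewrite -ler_pdivrMr// mul1r (le_trans (ltW (truncnS_gt _)))//.
by rewrite ler_nat.
Qed.

Let phi_sum (F : nat -> cfun X) N :
  phi (\sum_(i < N) F i) = \sum_(i < N) phi (F i).
Proof.
by elim: N => [|N IH]; rewrite ?big_ord0// !big_ord_recr/= phiD IH.
Qed.

Let sumE (F : nat -> cfun X) N x : (\sum_(i < N) F i) x = \sum_(i < N) F i x.
Proof.
by elim: N => [|N IH]; rewrite ?big_ord0// !big_ord_recr/= cfunDE IH.
Qed.

(** Dini's argument. Let f lie below the indicator of the union. The sums of the
    N-th bumps of the first N sets increase with N, and reach 1 at each point of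
    the union; elsewhere f vanishes. By compactness some N makes the sum at least
    f - e everywhere. *)
Let content_subadditive (U : nat -> set X) (s : \bar R) :
  (forall i, open (U i)) ->
  (forall N, (\sum_(i < N) (content (U i))%:E <= s)%E) ->
  ((content (\bigcup_i U i))%:E <= s)%E.
Proof.
move=> oU Us; apply/lee_addgt0Pr => e e0.
suff : forall f, below (\bigcup_i U i) f -> exists N,
    phi f <= \sum_(i < N) content (U i) + e.
  move=> H; case: s Us => [s| |] Us.
  - rewrite -EFinD lee_fin; apply: content_le => f /H[N /le_trans]; apply.
    by have := Us N; rewrite sumEFin lee_fin lerD2r.
  - by rewrite leey.
  - by have := Us 0%N; rewrite big_ord0.
move=> f fU.
(* N bounds both the number of sets and the steepness of the bumps *)
pose g N : cfun X := \sum_(i < N) bump (U i) N + e *: cfun1.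
suff [N fg] : exists N, forall x, f x <= g N x.
  exists N; rewrite (le_trans (phi_le fg))// phiD (phi_sum (fun i => bump (U i) N)).
  rewrite phiZ phi1 mulr1 lerD2r; apply: ler_sum => i _.
  exact: phi_le_content.
have gE N x : g N x = \sum_(i < N) bump (U i) N x + e.
  by rewrite /g cfunDE (sumE (fun i => bump (U i) N)) cfunZE cfun1E mulr1.
have g_mono x N M : (N <= M)%N -> g N x <= g M x.
  move=> NM; rewrite !gE lerD2r.
  rewrite -(big_mkord xpredT (fun i => bump (U i) N x)).
  rewrite -(big_mkord xpredT (fun i => bump (U i) M x)).
  rewrite [leRHS](big_cat_nat _ NM)//= -[leLHS]addr0 lerD//.
    apply: ler_sum => i _; rewrite !bumpE.
    by rewrite le_min ge_min lexx/= ge_min ler_wpM2r ?depth_ge0 ?ler_nat ?orbT.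
  by apply: sumr_ge0 => i _; have [/andP[]] := bump_below (U i) M x.
pose V N := [set x | f x < g N x].
have oV N : open (V N).
  rewrite (_ : V N = (g N - f) @^-1` [set t | 0 < t]).
    by have /continuousP := @cfun_cont _ _ (g N - f); apply; exact: open_gt.
  by apply/seteqP; split=> x; rewrite /V /= cfunBE subr_gt0.
have cV : [set: X] `<=` cover [set: nat] V.
  move=> x _; have [[i _ Uix]|nUx] := pselect ((\bigcup_i U i) x).
    have [k0 k0P] := bump_eventually1 (oU i) Uix.
    exists (maxn i.+1 k0) => //; rewrite /V /= gE.
    have iN : (i < maxn i.+1 k0)%N by rewrite leq_maxl.
    rewrite (bigD1 (Ordinal iN))//= k0P ?leq_maxr//.
    apply: (@le_lt_trans _ _ 1); first by have [/andP[]] := fU x.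
    rewrite -addrA ltrDl ltr_wpDl// sumr_ge0// => j _.
    by have [/andP[]] := bump_below (U j) (maxn i.+1 k0) x.
  exists 0%N => //; rewrite /V /= gE big_ord0 add0r.
  by have [_ ->] := fU x.
have := @space_compact _ X; rewrite compact_cover cover_compactE.
case/(_ nat setT V) => //; first by exists V => i _; [exact: oV|rewrite setTI].
move=> D _ DV; exists (\max_(i <- finmap.enum_fset D) i)%N => x.
have [i iD Vix] := DV x I.
by rewrite (le_trans (ltW Vix))// g_mono// leq_bigmax_seq.
Qed.

Let outer_adherent A e : 0 < e ->
  exists U, [/\ open U, A `<=` U & content U <= outer A + e].
Proof.
move=> e0; apply: contrapT => nex.
suff : outer A + e <= outer A by rewrite gerDl leNgt e0.
apply: outer_ge => U oU AU; rewrite leNgt; apply/negP => Ue.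
by apply: nex; exists U; split => //; exact: ltW.
Qed.

Let outer_sigma_subadditive : sigma_subadditive (fun A => (outer A)%:E).
Proof.
move=> F; apply/lee_addgt0Pr => e e0.
have eps_gt0 i : 0 < e / (2 ^ i.+1)%:R :> R by rewrite divr_gt0// ltr0n expn_gt0.
have [U UP] := choice (fun i => outer_adherent (F i) (eps_gt0 i)).
have oU i : open (U i) by have [] := UP i.
apply: le_trans (epsilon_trick xpredT _ (ltW e0)); last first.
  by move=> n; rewrite lee_fin outer_ge0.
apply: (@le_trans _ _ (content (\bigcup_i U i))%:E).
  rewrite lee_fin outer_le//; first exact: bigcup_open.
  by apply: subset_bigcup => i _; have [] := UP i.
apply: content_subadditive => // N.
apply: (@le_trans _ _
  (\sum_(0 <= i < N) ((outer (F i))%:E + (e / (2 ^ i.+1)%:R)%:E))%E).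
  rewrite big_mkord; apply: lee_sum => i _; rewrite -EFinD lee_fin.
  by have [] := UP i.
apply: nneseries_lim_ge => i _ _.
by rewrite -EFinD lee_fin addr_ge0 ?outer_ge0// ltW.
Qed.

(** Open sets split every set additively. Let V be an open set containing
    A, and f below the indicator of the intersection of V and U. The part of V
    where f < e is open and contains A minus U, because f vanishes outside U; and
    f + g <= 1 + e for every g below its indicator. *)
Let outer_open_split U A : open U ->
  outer (A `&` U) + outer (A `&` ~` U) <= outer A.
Proof.
move=> oU; apply: outer_ge => V oV AV.
apply: (@le_trans _ _ (content (V `&` U) + outer (A `&` ~` U))).
  rewrite lerD2r outer_le//; first exact: openI.
  exact: setSI.
rewrite -lerBrDr; apply: content_le => f fVU; rewrite lerBrDr.
apply/ler_addgt0Pr => e e0; rewrite -lerBrDl.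
pose W := V `&` [set x | f x < e].
apply: (@le_trans _ _ (content W)).
  apply: outer_le; first apply: openI => //.
    by have /continuousP cf := @cfun_cont _ _ f; exact: (cf _ (@open_lt _ e)).
  move=> x [Ax Ux]; split; first exact: AV.
  by rewrite /=; have [_ ->//] := fVU x; case.
apply: content_le => g gW; rewrite lerBrDl.
have e1 : 0 < 1 + e by rewrite addr_gt0.
have : below V ((1 + e)^-1 *: (f + g)).
  move=> x; rewrite !cfunE.
  have [/andP[f0 f1] fo] := fVU x; have [/andP[g0 g1] go] := gW x; split.
    rewrite mulr_ge0 ?addr_ge0 ?invr_ge0 ?(ltW e1)//=.
    rewrite ler_pdivrMl// mulr1; have [fe|fe] := ltP (f x) e.
      by rewrite addrC lerD// ltW.
    rewrite go; first by rewrite addr0 (le_trans f1)// lerDl ltW.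
    by move=> [_ /=]; rewrite ltNge fe.
  by move=> nV; rewrite fo ?go ?addr0 ?mulr0// => -[].
move=> /phi_le_content; rewrite phiZ phiD ler_pdivrMl// => /le_trans; apply.
by rewrite mulrDl mul1r lerD2l ler_piMr// ltW.
Qed.

Let outerM : {outer_measure set X -> \bar R} :=
  HB.pack (fun A => (outer A)%:E) (isOuterMeasure.Build R X (fun A => (outer A)%:E)
    (congr1 EFin outer0) (fun A => outer_ge0 A) (fun A B AB => outerS AB)
    outer_sigma_subadditive).

Let borel_caratheodory (A : set (borel X)) : measurable A ->
  outerM.-cara.-measurable A.
Proof.
apply: smallest_sub; first exact: sigma_algebra_measurable.
move=> U oU; apply: (@le_caratheodory_measurable _ _ outerM) => B.
by rewrite -EFinD lee_fin; exact: outer_open_split.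
Qed.

Let riesz_sigma_additive :
  semi_sigma_additive (fun A : set (borel X) => (outer A)%:E).
Proof.
move=> F mF tF mUF; apply: (@caratheodory_measure_sigma_additive _ _ outerM) => //.
- by move=> i; apply: borel_caratheodory.
- exact: borel_caratheodory.
Qed.

Let riesz_measure : borel_measure X :=
  HB.pack (fun A : set (borel X) => (outer A)%:E)
    (isMeasure.Build _ (borel X) R (fun A : set (borel X) => (outer A)%:E)
      (congr1 EFin outer0) (fun A => outer_ge0 A) riesz_sigma_additive).

Let rieszT : riesz_measure setT = 1%E.
Proof.
rewrite /riesz_measure /=; congr EFin; rewrite outer_open; last exact: openT.
apply/eqP; rewrite eq_le content_le1/= -phi1 phi_le_content// => x.
by split=> [|/(_ I)//]; rewrite cfun1E lexx ler01.
Qed.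

Let riesz_fin_pos : fin_pos_measure riesz_measure.
Proof. by apply/andP; rewrite rieszT lte01 ltry. Qed.

Let content_le_pairing U f : open U -> cfun_ge0 f -> (forall x, U x -> 1 <= f x) ->
  content U <= pairing f riesz_measure.
Proof.
move=> oU f0 f1; rewrite -outer_open// -[leLHS]/(fine (riesz_measure U)).
have mU : measurable (U : set (borel X)) by exact: open_borel.
pose chi (x : borel X) : R := (x \in (U : set (borel X)))%:R.
have -> : fine (riesz_measure U) = Rintegral riesz_measure setT chi.
  by have := @integral_indic _ _ R riesz_measure _ measurableT _ mU; rewrite setIT => <-.
have intU : riesz_measure.-integrable [set: borel X] (EFin \o chi).
  apply: measurable_bounded_integrable => //.
  - by rewrite rieszT ltry.
  - exact: measurable_indic.
  exists 1; split; first exact: num_real.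
  move=> M M1 x _ /=; rewrite /chi ger0_norm ?ler0n//.
  by rewrite (le_trans _ (ltW M1))// lern1 leq_b1.
apply: (le_Rintegral _ intU) => //; first exact: cfun_integrable.
move=> x _; rewrite /chi; case: (boolP (x \in (U : set (borel X)))) => [/set_mem/f1//|_].
exact: f0.
Qed.

(** One inequality suffices, since it can be applied to both f and - f. Cutting
    f into slices of height h, the part of f above level n + 1 is compared with
    the integral of the part above level n: between the two lies h times the
    measure of the set where f exceeds the level. The shift costs one slice. *)
Let phi_le_pairing01 f : (forall x, 0 <= f x <= 1) ->
  phi f <= pairing f riesz_measure.
Proof.
move=> f01; apply/ler_addgt0Pl => e e0.
pose N := (Num.truncn e^-1).+1; pose h : R := N%:R^-1.
have N0 : 0 < N%:R :> R by rewrite ltr0n.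
have h0 : 0 < h by rewrite invr_gt0.
have he : h <= e.
  by rewrite /h -[leRHS]invrK lef_pV2 ?posrE ?invr_gt0// ltW// truncnS_gt.
pose cut n : cfun X := cfun_min f ((n%:R * h) *: cfun1).
have cutE n x : cut n x = Num.min (f x) (n%:R * h).
  by rewrite -[RHS]/(Num.min _ _) -[in RHS](mulr1 (n%:R * h)).
have cutS n x : cut n.+1 x - cut n x =
    if f x <= n%:R * h then 0 else Num.min (f x - n%:R * h) h.
  rewrite !cutE -natr1 mulrDl mul1r; move: (f x) (n%:R * h) => t a.
  have [ta|a_t] := leP t a; first by rewrite min_l ?subrr// ler_wpDr// ltW.
  have [th|th] := leP (t - a) h; first by rewrite min_l//; lra.
  by rewrite min_r; lra.
suff main n : phi (cut n.+1) <= h + pairing (cut n) riesz_measure.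
  have -> : phi f = phi (cut N.+1).
    congr phi; apply: cfunP => x; rewrite cutE; apply/esym/min_idPl.
    have /andP[_ fx1] := f01 x; apply: (le_trans fx1).
    by rewrite -ler_pdivrMr// mul1r invrK ler_nat.
  rewrite (le_trans (main _))// lerD//; apply: pairing_le => // x.
  by rewrite cutE ge_min lexx.
elim: n => [|n IH].
  apply: (@le_trans _ _ (phi (h *: cfun1))).
    by apply: phi_le => x; rewrite cutE cfunZE cfun1E mul1r mulr1 ge_min lexx orbT.
  rewrite phiZ phi1 mulr1 lerDl.
  have -> : (0 : R) = pairing (0 : cfun X) riesz_measure.
    by rewrite -(scale0r (0 : cfun X)) pairingZ// mul0r.
  apply: pairing_le => // x; rewrite cutE mul0r cfun0E le_min lexx andbT.
  by have /andP[] := f01 x.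
pose U := [set x | n.+1%:R * h < f x].
have oU : open U.
  by have /continuousP cf := @cfun_cont _ _ f; exact: (cf _ (@open_gt _ _)).
have up : phi (N%:R *: (cut n.+2 - cut n.+1)) <= content U.
  apply: phi_le_content => x; rewrite cfunZE cfunBE cutS.
  have [fn|fn] := leP (f x) (n.+1%:R * h).
    by rewrite mulr0 lexx ler01.
  split; last by case.
  rewrite mulr_ge0 ?le_min ?subr_ge0 ?(ltW fn) ?(ltW h0) ?(ltW N0)//=.
  by rewrite -ler_pdivlMl// mulr1 ge_min lexx orbT.
have down : content U <= pairing (N%:R *: (cut n.+1 - cut n)) riesz_measure.
  apply: content_le_pairing => // x; rewrite cfunZE cfunBE cutS.
    have [fn|fn] := leP (f x) (n%:R * h); first by rewrite mulr0.
    by rewrite mulr_ge0 ?(ltW N0)// le_min subr_ge0 (ltW fn) ltW.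
  rewrite /U /= -natr1 mulrDl mul1r => fn.
  have hn : n%:R * h < f x by rewrite (le_lt_trans _ fn)// lerDl ltW.
  rewrite (leNgt (f x)) hn /= -ler_pdivrMl// mulr1 le_min lexx andbT.
  by rewrite lerBrDl ltW.
have := le_trans up down; rewrite phiZ pairingZ// ler_pM2l//.
rewrite phiB pairingB//; lra.
Qed.

Theorem riesz : exists m : borel_measure X,
  m setT = 1%E /\ forall f, pairing f m = phi f.
Proof.
exists riesz_measure; split=> // f.
have main g : phi g <= pairing g riesz_measure.
  (* (g + |g|) / c takes its values in [0, 1] *)
  pose c := 2 * `|g| + 1; have c0 : 0 < c by rewrite ltr_wpDl// mulr_ge0.
  have := phi_le_pairing01 (f := c^-1 *: (g + `|g| *: cfun1)).
  rewrite phiZ pairingZ// phiD pairingD// phiZ pairingZ// phi1 pairing1 rieszT/=.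
  rewrite ler_pM2l ?invr_gt0// lerD2r; apply => x; rewrite !cfunE mulr1.
  have := cfun_norm_ub g x; rewrite ler_norml => /andP[g1 g2].
  rewrite mulr_ge0 ?invr_ge0 ?(ltW c0)//=; last by rewrite -lerBlDr sub0r.
  by rewrite ler_pdivrMl// mulr1 /c; lra.
apply/eqP; rewrite eq_le main andbT.
have := main (- f); rewrite -scaleN1r phiZ pairingZ//.
by rewrite !mulN1r lerN2.
Qed.

End riesz.

(** * Contraction of cones by products of operators *)

Section cone_sequences.
Context {R : realType} {I : choiceType} {succ : I -> I}.
Variables (X : I -> compactMetricType R) (Lam : forall n, set (cfun (X n))).
Arguments Lam : clear implicits.
Variables (kappa Delta : R) (tau : nat).
Variable L : opseq succ X.
Hypothesis kappa_ge1 : 1 <= kappa.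
Hypothesis L_adm : admissible Lam kappa Delta tau L.
Local Notation block := tau.+1.

(** Ratio of the comparison constants between images of cone elements under a
    block; an operator is prepended to the tau of the diameter condition so that
    blocks are never empty. The factor 2 leaves room to approximate the supremum
    and the infimum in the Hilbert metric instead of attaining them. *)
Definition distortion : R := 2 * expR Delta.
(** The factor by which a block shrinks oscillations. *)
Definition rate : R := 1 - distortion^-1.
Local Notation D := distortion.

(** The order of the cone: f precedes g when g - f lies in this set. *)
Definition ccone n : set (cfun (X n)) := Lam n `|` [set 0].

(** a g <= f <= b g in the order of the cone. *)
Definition cone_between n (a b : R) (f g : cfun (X n)) :=
  ccone (f - a *: g) /\ ccone (b *: g - f).

Let admC1 : C1 Lam. Proof. by case: L_adm. Qed.
Let admC2 : C2 Lam kappa Delta tau L. Proof. by case: L_adm. Qed.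

Lemma cone1 n : Lam n cfun1. Proof. by have [] := admC1 n. Qed.

Lemma coneD n f g : Lam n f -> Lam n g -> Lam n (f + g).
Proof. by have [[[_ _]] H _ _ _] := admC1 n; exact: H. Qed.

Lemma coneZ n (t : R) f : 0 < t -> Lam n f -> Lam n (t *: f).
Proof.
by move=> t0 nf; have [[[_ H _] _] _ _] := admC1 n; rewrite -(H t t0); exists f.
Qed.

Lemma cone_ge0 n f : Lam n f -> cfun_ge0 f.
Proof. by have [_ _ H] := admC1 n; move=> /H[]. Qed.

Lemma cone_pos_point n f : Lam n f -> exists x, 0 < f x.
Proof.
move=> nf; have [_ _ /(_ f nf)[f0 fN0]] := admC1 n.
apply: contrapT => nex; apply: fN0; apply/funext => x.
apply/eqP; rewrite eq_le f0 andbT leNgt; apply/negP => fx; apply: nex.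
by exists x.
Qed.

Lemma ccone_ge0 n f : ccone f -> @cfun_ge0 R (X n) f.
Proof. by case=> [/cone_ge0//|->] x; rewrite cfun0E. Qed.

Lemma cconeD n f g : @ccone n f -> ccone g -> ccone (f + g).
Proof.
move=> [nf|->]; last by rewrite add0r.
by move=> [ng|->]; [left; exact: coneD|rewrite addr0; left].
Qed.

Lemma ccone_scale_ge0 n (t : R) g : Lam n g -> ccone (t *: g) -> 0 <= t.
Proof.
move=> /cone_pos_point[x gx] /ccone_ge0/(_ x); rewrite cfunZE.
by rewrite pmulr_lge0.
Qed.

(** The dual maps point masses to positive measures, which is positivity of the
    operator on all continuous functions and not only on the cone. *)
Lemma op_ge0 n f : cfun_ge0 f -> cfun_ge0 (L n f).
Proof.
move=> f0 x; have [_ dL _ _ _] := L_adm.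
have [m _ mE] := dL n (point_mass x) (point_mass_fin_pos x).
rewrite -[leRHS]pairing_point_mass -[leRHS]/(dual (L n) (point_mass x) f) -mE.
exact: Rintegral_ge0.
Qed.

Lemma op_cone n f : Lam n f -> Lam (succ n) (L n f).
Proof. by move=> nf; have [_ [H _ _ _ _]] := admC2 n; apply: H; exists f. Qed.

Lemma op1_bounds n x : kappa^-1 <= L n cfun1 x <= kappa.
Proof. by have [_ [_ H _ _ _]] := admC2 n. Qed.

Let kappa_gt0 : 0 < kappa. Proof. exact: lt_le_trans kappa_ge1. Qed.

Section products.

Lemma opprodD k n f g : opprod L k n (f + g) = opprod L k n f + opprod L k n g.
Proof. by elim: k n f g => //= k IH n f g; rewrite linearD IH. Qed.

Lemma opprodZ k n a f : opprod L k n (a *: f) = a *: opprod L k n f.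
Proof. by elim: k n f => //= k IH n f; rewrite linearZ IH. Qed.

Lemma opprodB k n f g : opprod L k n (f - g) = opprod L k n f - opprod L k n g.
Proof. by rewrite -scaleN1r opprodD opprodZ scaleN1r. Qed.

Lemma opprod_ge0 k n f : cfun_ge0 f -> cfun_ge0 (opprod L k n f).
Proof. by elim: k n f => //= k IH n f f0; apply/IH/op_ge0. Qed.

Lemma opprod_le k n (f g : cfun (X n)) : (forall x, f x <= g x) ->
  forall x, opprod L k n f x <= opprod L k n g x.
Proof.
move=> fg x; rewrite -subr_ge0 -cfunBE -opprodB.
by apply: opprod_ge0 => y; rewrite cfunBE subr_ge0.
Qed.

Lemma opprod_cone k n f : Lam n f -> Lam _ (opprod L k n f).
Proof. by elim: k n f => //= k IH n f nf; apply/IH/op_cone. Qed.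

Lemma opprod_ccone k n f : @ccone n f -> ccone (opprod L k n f).
Proof.
case=> [nf|->]; first by left; exact: opprod_cone.
by right; rewrite /= -(scale0r (0 : cfun (X n))) opprodZ scale0r.
Qed.

Lemma opprod_between k n a b f g : @cone_between n a b f g ->
  cone_between a b (opprod L k n f) (opprod L k n g).
Proof. by move=> [fa fb]; split; rewrite -opprodZ -opprodB; exact: opprod_ccone. Qed.

(** The product of j + k operators lands in X (n + (j + k)), while applying k
    operators after j lands in X ((n + j) + k), an equal but not convertible
    space; quantifying over predicates spares the cast. *)
Lemma opprod_add j k n
    (P : forall m, (cfun (X n) -> cfun (X m)) -> Prop) :
  P _ (fun f => opprod L k (advance succ j n) (opprod L j n f)) ->
  P _ (opprod L (j + k) n).
Proof.
elim: j n P => [|j IH] n P //= H.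
exact: (IH (succ n) (fun m A => P m (fun f => A (L n f)))).
Qed.

Lemma opprod1_bounds k n x : kappa ^- k <= opprod L k n cfun1 x <= kappa ^+ k.
Proof.
elim: k n x => [|k IH] n x /=; first by rewrite !expr0 invr1 cfun1E lexx.
have /andP[lo hi] := IH (succ n) x; apply/andP; split.
- apply: (@le_trans _ _ (opprod L k (succ n) (kappa^-1 *: cfun1) x)).
    by rewrite opprodZ cfunZE exprS invfM ler_pM2l ?invr_gt0.
  apply: opprod_le => y; rewrite cfunZE cfun1E mulr1.
  by have /andP[] := op1_bounds y.
- apply: (@le_trans _ _ (opprod L k (succ n) (kappa *: cfun1) x)).
    apply: opprod_le => y; rewrite cfunZE cfun1E mulr1.
    by have /andP[] := op1_bounds y.
  by rewrite opprodZ cfunZE exprS ler_pM2l.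
Qed.

Lemma opprod1_gt0 k n x : 0 < opprod L k n cfun1 x.
Proof.
have /andP[+ _] := opprod1_bounds x; apply: lt_le_trans.
by rewrite invr_gt0 exprn_gt0.
Qed.

Lemma opprod_norm k n f x : `|opprod L k n f x| <= `|f| * opprod L k n cfun1 x.
Proof.
rewrite -cfunZE -opprodZ ler_norml -cfunNE -scaleN1r -opprodZ.
apply/andP; split; apply: opprod_le => y; rewrite !cfunE mulr1 ?mulN1r.
  by have := cfun_norm_ub f y; rewrite ler_norml => /andP[].
by have := cfun_norm_ub f y; rewrite ler_norml => /andP[].
Qed.

Lemma norm_opprod_le k n f : `|opprod L k n f| <= kappa ^+ k * `|f|.
Proof.
apply: cfun_norm_le => x; rewrite (le_trans (opprod_norm _ _))// mulrC.
by rewrite ler_wpM2r//; have /andP[] := opprod1_bounds x.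
Qed.

End products.

Section contraction.
Hypothesis Delta_gt0 : 0 < Delta.

Lemma distortion_gt1 : 1 < D.
Proof.
rewrite /D; have := expR_gt0 Delta; have : 1 < expR Delta by rewrite expR_gt1.
lra.
Qed.

Let D_gt0 : 0 < D. Proof. exact: lt_trans distortion_gt1. Qed.

Lemma rate_gt0 : 0 < rate.
Proof. by rewrite subr_gt0 invf_lt1// distortion_gt1. Qed.

Lemma rate_lt1 : rate < 1.
Proof. by rewrite gtrBl invr_gt0. Qed.

(** A finite projective distance means that the supremum A is positive and the
    infimum B finite; positivity of f and g at some point excludes the degenerate
    values A = +oo and B = 0, for which B / A carries no information. *)
Lemma hilbert_between n f g : Lam n f -> Lam n g ->
  (hilbert_metric (Lam n) g f <= Delta%:E)%E ->
  exists a b, [/\ 0 < a, b <= D * a & cone_between a b f g].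
Proof.
move=> nf ng; rewrite /hilbert_metric.
have [x fx] := cone_pos_point nf; have [y gy] := cone_pos_point ng.
have gN0 : 0 < `|g|.
  by rewrite (lt_le_trans gy)// (le_trans _ (cfun_norm_ub g y))// ler_norm.
have A0 : (0 <= hilbertA (Lam n) g f)%E by apply: ereal_sup_ubound; left.
have Aub : (hilbertA (Lam n) g f <= (f y / g y)%:E)%E.
  apply: ge_ereal_sup => _ [->|[t [t0 tf] <-]].
    by rewrite lee_fin divr_ge0 ?(cone_ge0 nf) ?ltW.
  rewrite lee_fin ler_pdivlMr//.
  by have /ccone_ge0/(_ y) := tf; rewrite cfunBE cfunZE subr_ge0.
have Blb : ((f x / `|g|)%:E <= hilbertB (Lam n) g f)%E.
  apply: le_ereal_inf_tmp => _ [t [t0 tf] <-].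
  rewrite lee_fin ler_pdivrMr//.
  have /ccone_ge0/(_ x) := tf; rewrite cfunBE cfunZE subr_ge0 => /le_trans; apply.
  by rewrite ler_wpM2l ?(ltW t0)// (le_trans _ (cfun_norm_ub g x))// ler_norm.
have B0 : (0 < hilbertB (Lam n) g f)%E.
  by apply: lt_le_trans Blb; rewrite lte_fin divr_gt0.
case EA : (hilbertA (Lam n) g f) A0 Aub => [a| |] //; last first.
rewrite lee_fin => a0 _.
case EB : (hilbertB (Lam n) g f) B0 Blb => [b| |] // B0 _ le_Delta.
- have {}a0 : 0 < a.
    rewrite lt_neqAle a0 andbT; apply/eqP => a_eq0; move: le_Delta.
    by rewrite -a_eq0 inve0 gt0_muley.
  rewrite lte_fin in B0.
  have ab : b <= expR Delta * a.
    move: le_Delta; rewrite inver gt_eqF// -EFinM lne_EFin ?divr_gt0// lee_fin => ba.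
    have : expR (ln (b / a)) <= expR Delta by rewrite ler_expR.
    by rewrite lnK ?posrE ?divr_gt0// ler_pdivrMr.
  (* any s > 2/3 a and t < 4/3 b have t / s < 2 b / a <= D *)
  have : ((2 / 3 * a)%:E < hilbertA (Lam n) g f)%E by rewrite EA lte_fin; lra.
  move=> /ereal_sup_gt[_ [->|[s [s0 sf] <-]]]; first by rewrite lte_fin; lra.
  have : (hilbertB (Lam n) g f < (4 / 3 * b)%:E)%E by rewrite EB lte_fin; lra.
  move=> /ereal_inf_lt[_ [t [t0 tf] <-]] bt as_.
  exists s, t; split => //; rewrite !lte_fin in as_ bt.
  rewrite (le_trans (ltW bt))//; apply: (@le_trans _ _ (D * (2 / 3 * a))).
    by rewrite /D; lra.
  by rewrite ler_pM2l// ltW.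
- exfalso; move: le_Delta.
  rewrite inver; case: eqP => [_|/eqP aN0]; first by rewrite gt0_mulye.
  by rewrite gt0_mulye// lte_fin invr_gt0 lt_neqAle eq_sym aN0.
Qed.

Lemma block_between n (f g : cfun (X n)) : Lam n f -> Lam n g ->
  exists a b, [/\ 0 < a, b <= D * a &
    cone_between a b (opprod L block n f) (opprod L block n g)].
Proof.
move=> nf ng; apply: hilbert_between; try exact: opprod_cone.
have [_ [_ _ _ + _]] := admC2 (succ n); apply: le_trans.
apply: ereal_sup_ubound.
exists (opprod L block n g, opprod L block n f) => //.
by split; [exists (L n g)|exists (L n f)] => //; exact: op_cone.
Qed.

(** Slacks may vanish, hence the version with the origin included. *)
Lemma block_betweenK n (u g : cfun (X n)) : ccone u -> Lam n g ->
  exists a b, [/\ 0 <= a, b <= D * a &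
    cone_between a b (opprod L block n u) (opprod L block n g)].
Proof.
move=> [nu|->] ng; first by have [a [b [/ltW]]] := block_between nu ng; exists a, b.
exists 0, 0; split; rewrite ?mulr0//.
have -> : opprod L block n 0 = 0.
  by rewrite -(scale0r (0 : cfun (X n))) opprodZ scale0r.
by split; rewrite scale0r subrr; right.
Qed.

(** The mechanism of Birkhoff's theorem, in linear form: the two slacks f - a g
    and b g - f are both pushed by a block of operators inside the cone, at
    least a fraction 1/D of the way to g, and their sum is (b - a) g. *)
Lemma block_contract n a b (f g : cfun (X n)) : Lam n g -> cone_between a b f g ->
  exists a' b', [/\ a <= a', b' <= b, b' - a' <= rate * (b - a) &
    cone_between a' b' (opprod L block n f) (opprod L block n g)].
Proof.
move=> ng [Ku Kv].
have [A [B [A0 BA [Au uB]]]] := block_betweenK Ku ng.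
have [A' [B' [A'0 BA' [Av vB]]]] := block_betweenK Kv ng.
set T := opprod L block n in Au uB Av vB *.
have TB p q : T (p - q) = T p - T q by exact: opprodB.
have TZ t p : T (t *: p) = t *: T p by exact: opprodZ.
exists (a + A), (b - A'); split.
- by rewrite lerDl.
- by rewrite gerBl.
- have S : 0 <= B + B' - (b - a).
    apply: (@ccone_scale_ge0 _ _ (T g)); first exact: opprod_cone.
    have := cconeD uB vB; rewrite !TB !TZ; congr ccone; apply: cfunP => x.
    by rewrite !cfunE; ring.
  have -> : rate * (b - a) = (b - a) - (b - a) / D by rewrite /rate; ring.
  suff : (b - a) / D <= A + A' by lra.
  by rewrite ler_pdivrMr//; lra.
- split; first by move: Au; rewrite TB TZ -addrA -opprD -scalerDl.
  move: Av; rewrite TB TZ; congr ccone; apply: cfunP => x.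
  by rewrite !cfunE; ring.
Qed.

Lemma blocks_squeeze j n a b (f g : cfun (X n)) : Lam n g -> cone_between a b f g ->
  exists a' b', [/\ a <= a', a' <= b', b' - a' <= rate ^+ j * (b - a) &
    forall k, (j * block <= k)%N -> forall x,
      a' * opprod L k n g x <= opprod L k n f x <= b' * opprod L k n g x].
Proof.
elim: j n a b f g => [|j IH] n a b f g ng fg.
  exists a, b; split => //; last 2 first.
  - by rewrite expr0 mul1r.
  - move=> k _ x; have [Ka Kb] := opprod_between k fg.
    have := ccone_ge0 Ka x; have := ccone_ge0 Kb x.
    by rewrite !cfunE !subr_ge0 => -> ->.
  rewrite -subr_ge0; apply: (@ccone_scale_ge0 _ _ g) => //.
  have [Ka Kb] := fg; have := cconeD Kb Ka; congr ccone.
  by apply: cfunP => x; rewrite !cfunE; ring.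
have [a1 [b1 [aa1 bb1 ab1 fg1]]] := block_contract ng fg.
have [a' [b' [aa' ab' ba' H]]] := IH _ _ _ _ _ (opprod_cone block ng) fg1.
exists a', b'; split => //; first exact: le_trans aa'.
  rewrite (le_trans ba')// exprSr -mulrA ler_wpM2l// exprn_ge0//.
  exact: ltW rate_gt0.
move=> k; rewrite mulSn => kP.
have bk : (block <= k)%N by rewrite (leq_trans _ kP)// leq_addr.
rewrite -(subnKC bk); apply: (@opprod_add block (k - block) n
  (fun m A => forall x, a' * A g x <= A f x <= b' * A g x)).
by apply: H; rewrite leq_subRL.
Qed.

(** The first block makes f and g comparable at all, with ratio at most D; each
    of the next j blocks contracts. Pointwise inequalities are then kept by any
    further operators. *)
Lemma projective_squeeze j n (f g : cfun (X n)) : Lam n f -> Lam n g ->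
  exists a b, [/\ 0 < a, a <= b, b - a <= D * rate ^+ j * a &
    forall k, (j.+1 * block <= k)%N -> forall x,
      a * opprod L k n g x <= opprod L k n f x <= b * opprod L k n g x].
Proof.
move=> nf ng; have [A [B [A0 BA fg]]] := block_between nf ng.
have [a [b [Aa ab ba H]]] := blocks_squeeze j (opprod_cone block ng) fg.
exists a, b; split => //; first exact: lt_le_trans Aa.
  rewrite (le_trans ba)// (mulrC D) -mulrA ler_wpM2l ?exprn_ge0//.
    exact: ltW rate_gt0.
  by have := ler_wpM2l (ltW D_gt0) Aa; lra.
move=> k; rewrite mulSn => kP.
have bk : (block <= k)%N by rewrite (leq_trans _ kP)// leq_addr.
rewrite -(subnKC bk); apply: (@opprod_add block (k - block) n
  (fun m A => forall x, a * A g x <= A f x <= b * A g x)).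
by apply: H; rewrite leq_subRL.
Qed.

End contraction.
End cone_sequences.

(** * The limit measures and the multipliers *)

Section real_sequences.
Context {R : realType}.

Lemma cvgR_unique (u : nat -> R) (a b : R) :
  u k @[k --> \oo] --> a -> u k @[k --> \oo] --> b -> a = b.
Proof. by move=> ua ub; exact: (cvg_unique (@Rhausdorff R) ua ub). Qed.

Lemma cvg_of_cauchy (u : nat -> R) :
  (forall e, 0 < e -> exists c k0, forall k, (k0 <= k)%N -> `|u k - c| <= e) ->
  exists l : R, u k @[k --> \oo] --> l.
Proof.
move=> H; suff : cvg (u k @[k --> \oo]) by move=> /cvg_ex.
apply: R_complete; apply: cauchy_exP => e e0.
have [c [k0 k0P]] := H (e / 2) (divr_gt0 e0 (ltr0n _ 2)).
exists c, k0 => // k /= k0k; rewrite /ball /= distrC.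
by rewrite (le_lt_trans (k0P _ k0k))// ltr_pdivrMr// ltr_pMr// ltr1n.
Qed.

Lemma geometric_le (t c e : R) : 0 < t < 1 -> 0 < e -> exists j, c * t ^+ j <= e.
Proof.
move=> /andP[t0 t1] e0.
have tn : `|t| < 1 by rewrite gtr0_norm.
have /cvgrPdist_le/(_ _ e0)[j _ /(_ j (leqnn j))] := @cvg_geometric R c t tn.
move=> /= H; exists j; rewrite sub0r normrN in H.
exact: le_trans (ler_norm _) H.
Qed.

Lemma ler_dist_approx (p p' q q' u w : R) : `|p - q| <= u -> `|p' - q'| <= u ->
  `|q - q'| <= w -> `|p - p'| <= 2 * u + w.
Proof.
rewrite !ler_norml => /andP[? ?] /andP[? ?] /andP[? ?].
by apply/andP; split; lra.
Qed.

End real_sequences.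

Section limit_measure.
Context {R : realType} {I : choiceType} {succ : I -> I}.
Variables (X : I -> compactMetricType R) (Lam : forall n, set (cfun (X n))).
Arguments Lam : clear implicits.
Variables (kappa Delta : R) (tau : nat).
Variable L : opseq succ X.
Hypotheses (kappa_ge1 : 1 <= kappa) (Delta_gt0 : 0 < Delta).
Hypothesis L_adm : admissible Lam kappa Delta tau L.
Local Notation block := tau.+1.
Local Notation D := (distortion Delta).
Local Notation rate := (rate Delta).

Let quotient n k (f : cfun (X n)) (s : borel_measure (X (advance succ k n))) : R :=
  pairing (opprod L k n f) s / pairing (opprod L k n cfun1) s.

Section quotients.
Variables (n : I) (k : nat) (s : borel_measure (X (advance succ k n))).
Hypothesis s_pos : fin_pos_measure s.

Lemma opprod1_pairing_gt0 : 0 < pairing (opprod L k n cfun1) s.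
Proof.
apply: (@lt_le_trans _ _ (pairing (kappa ^- k *: cfun1) s)).
  by rewrite pairingZ// mulr_gt0 ?pairing1_gt0// invr_gt0 exprn_gt0//;
     exact: lt_le_trans kappa_ge1.
apply: pairing_le => // x; rewrite cfunZE cfun1E mulr1.
by have /andP[] := opprod1_bounds kappa_ge1 L_adm x.
Qed.

Lemma quotient_bounds (f : cfun (X n)) a b :
  (forall x, a * opprod L k n cfun1 x <= opprod L k n f x
             <= b * opprod L k n cfun1 x) ->
  a <= quotient f s <= b.
Proof.
move=> H; have g0 := opprod1_pairing_gt0.
rewrite /quotient ler_pdivlMr// ler_pdivrMr// -!pairingZ//.
by apply/andP; split; apply: pairing_le => // x; rewrite cfunZE; have /andP[] := H x.
Qed.

Lemma quotientB (f g : cfun (X n)) : quotient (f - g) s = quotient f s - quotient g s.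
Proof. by rewrite /quotient (opprodB L) pairingB// mulrBl. Qed.

Lemma quotientD (f g : cfun (X n)) : quotient (f + g) s = quotient f s + quotient g s.
Proof. by rewrite /quotient opprodD pairingD// mulrDl. Qed.

Lemma quotientZ a (f : cfun (X n)) : quotient (a *: f) s = a * quotient f s.
Proof. by rewrite /quotient opprodZ pairingZ// mulrA. Qed.

Lemma quotient1 : quotient cfun1 s = 1.
Proof. by rewrite /quotient divff// gt_eqF// opprod1_pairing_gt0. Qed.

Lemma quotient_norm (f : cfun (X n)) : `|quotient f s| <= `|f|.
Proof.
rewrite ler_norml; apply: quotient_bounds => x.
have := opprod_norm L_adm f x.
by rewrite ler_norml mulNr.
Qed.

End quotients.

(** Convergence of the quotients uniformly over the test measures. It is proved
    on cones first, and this form passes to differences and to uniform limits,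
    because quotients are linear of norm 1; so it holds on all of C(X n). *)
Let stabilizes n (f : cfun (X n)) := forall e, 0 < e -> exists c k0,
  forall k, (k0 <= k)%N -> forall s : borel_measure (X (advance succ k n)),
    fin_pos_measure s -> `|quotient f s - c| <= e.

Let stabilizes_cone_preoo n (f : cfun (X n)) : cone_preoo Lam L n f -> stabilizes f.
Proof.
move=> [p _ [fpos pf]] e e0.
have [j je] := geometric_le (D * `|f|)
  (introT andP (conj (rate_gt0 Delta_gt0) (rate_lt1 Delta_gt0))) e0.
have p1 : Lam _ (opprod L p n cfun1) by apply: (opprod_cone L_adm); exact: cone1 L_adm _.
have [a [b [a0 ab ba H]]] := projective_squeeze L_adm Delta_gt0 j pf p1.
have {}H k : (p + j.+1 * block <= k)%N -> forall x,
    a * opprod L k n cfun1 x <= opprod L k n f x <= b * opprod L k n cfun1 x.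
  move=> kP; have pk : (p <= k)%N by rewrite (leq_trans _ kP)// leq_addr.
  rewrite -(subnKC pk); apply: (@opprod_add _ _ _ _ _ p (k - p) n
    (fun m A => forall x, a * A cfun1 x <= A f x <= b * A cfun1 x)).
  by apply: H; rewrite leq_subRL.
have af : a <= `|f|.
  pose k := (p + j.+1 * block)%N; pose x : X (advance succ k n) := point.
  rewrite -(ler_pM2r (opprod1_gt0 kappa_ge1 L_adm x)).
  have /andP[/le_trans + _] := H k (leqnn _) x; apply.
  exact: le_trans (ler_norm _) (opprod_norm L_adm f x).
exists a, (p + j.+1 * block)%N => k kP s s0.
have /andP[lo hi] := quotient_bounds s0 (H k kP).
rewrite ger0_norm ?subr_ge0// (le_trans (lerB hi (lexx _)))// (le_trans ba)//.
apply: le_trans je.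
have C0 : 0 <= D by rewrite ltW// (lt_trans ltr01)// distortion_gt1.
rewrite -(mulrA D) -(mulrA D `|f|); apply: ler_wpM2l => //.
by rewrite mulrC; apply: ler_wpM2r => //; rewrite exprn_ge0// ltW// rate_gt0.
Qed.

Let stabilizesT n (f : cfun (X n)) : stabilizes f.
Proof.
move=> e e0; have e3 : 0 < e / 3 by rewrite divr_gt0.
have [_ _ _ _ L_C3] := L_adm.
have [g [fg [[g1 g2] /= [G1 G2] gE]]] : (ball f (e / 3) `&`
    [set p.1 - p.2 | p in cone_preoo Lam L n `*` cone_preoo Lam L n]) !=set0.
  apply: L_C3; last exact: ball_open.
  by exists f; exact: ballxx.
have [c1 [k1 k1P]] := stabilizes_cone_preoo G1 e3.
have [c2 [k2 k2P]] := stabilizes_cone_preoo G2 e3.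
exists (c1 - c2), (maxn k1 k2) => k; rewrite geq_max => /andP[kk1 kk2] s s0.
have fgE : `|quotient f s - quotient g s| <= e / 3.
  rewrite -quotientB// (le_trans (quotient_norm s0 _))//.
  by move: fg; rewrite -ball_normE /= => /ltW.
have := k1P k kk1 s s0; have := k2P k kk2 s s0.
move: fgE; rewrite -gE quotientB// !ler_norml => /andP[? ?] /andP[? ?] /andP[? ?].
by apply/andP; split; lra.
Qed.

Let limit_functional n (f : cfun (X n)) : exists l : R,
  forall s, test_measures s ->
    quotient f (s (advance succ k n)) @[k --> \oo] --> l.
Proof.
pose s0 m : borel_measure (X m) := point_mass point.
have s0P : test_measures s0 by move=> m; exact: point_mass_fin_pos.
have [e e0|l /cvgrPdist_le ul] :=
    @cvg_of_cauchy R (fun k => quotient f (s0 (advance succ k n))).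
  have [c [k0 H]] := stabilizesT f e0; exists c, k0 => k k0k; exact: H.
exists l => s sP; apply/cvgrPdist_le => e e0.
have e3 : 0 < e / 3 by rewrite divr_gt0.
have [c [k0 H]] := stabilizesT f e3.
have [k1 _ H1] := ul _ e3.
near=> k.
have k0k : (k0 <= k)%N by near: k; exact: nbhs_infty_ge.
have k1k : (k1 <= k)%N by near: k; exact: nbhs_infty_ge.
have := H k k0k _ (sP _); have := H k k0k _ (s0P _); have := H1 k k1k.
rewrite /= !ler_norml => /andP[? ?] /andP[? ?] /andP[? ?].
by apply/andP; split; lra.
Unshelve. all: by end_near. Qed.

(** The limit functional is positive and normalized, so the Riesz representation
    theorem turns it into a measure. *)
Lemma lim_mP n : is_m L n (lim_m L n).
Proof.
rewrite /lim_m; apply: (xgetPex (mzero : borel_measure (X n))).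
have [phi phiP] := choice (@limit_functional n).
pose s m : borel_measure (X m) := point_mass point.
have sP : test_measures s by move=> m; exact: point_mass_fin_pos.
have [m [mT mphi]] : exists m : borel_measure (X n),
    m setT = 1%E /\ forall f, pairing f m = phi f.
  apply: riesz => [f g|a f|f f0|].
  - apply: cvgR_unique (phiP (f + g) s sP) _.
    under eq_fun do rewrite quotientD ?sP//.
    exact: cvgD (phiP f s sP) (phiP g s sP).
  - apply: cvgR_unique (phiP (a *: f) s sP) _.
    under eq_fun do rewrite quotientZ ?sP//.
    exact: cvgM (cvg_cst _) (phiP f s sP).
  - apply: ler_cvg_to (cvg_cst 0) (phiP f s sP) _; apply: nearW => k.
    rewrite divr_ge0//; last exact/ltW/opprod1_pairing_gt0.
    by apply: Rintegral_ge0 => x _; exact: (opprod_ge0 L_adm).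
  - apply: cvgR_unique (phiP cfun1 s sP) _.
    under eq_fun do rewrite quotient1 ?sP//.
    exact: cvg_cst.
exists m; split; first by rewrite /fin_pos_measure /= mT lte01 ltry.
by move=> s' s'P f; rewrite mphi; exact: phiP.
Qed.

Lemma lim_m_fin_pos n : fin_pos_measure (lim_m L n).
Proof. by have [] := lim_mP n. Qed.

(** The quotients for point masses, which compute the limit measure. *)
Let evaluation n (f : cfun (X n)) k : R :=
  opprod L k n f point / opprod L k n cfun1 point.

Let evaluation_cvg n f : @evaluation n f k @[k --> \oo] --> pairing f (lim_m L n).
Proof.
have [_ /(_ (fun m => point_mass point)) H] := lim_mP n.
have {H} := H (fun m => point_mass_fin_pos point) f.
apply: cvg_trans; apply: near_eq_cvg; apply: nearW => k.
by rewrite /dual !pairing_point_mass.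
Qed.

Lemma lim_m1 n : pairing cfun1 (lim_m L n) = 1.
Proof.
apply: (cvgR_unique (@evaluation_cvg n cfun1)).
rewrite (_ : evaluation _ = fun=> 1); first exact: cvg_cst.
by apply/funext => k; rewrite /evaluation divff// gt_eqF// (opprod1_gt0 kappa_ge1 L_adm).
Qed.

Lemma lim_m_norm n f : `|pairing f (lim_m L n)| <= `|f|.
Proof.
have fin := lim_m_fin_pos n.
have b1 : pairing f (lim_m L n) <= pairing (`|f| *: cfun1) (lim_m L n).
  apply: pairing_le => // x; rewrite cfunZE cfun1E mulr1.
  exact: le_trans (ler_norm _) (cfun_norm_ub f x).
have b2 : pairing ((- `|f|) *: cfun1) (lim_m L n) <= pairing f (lim_m L n).
  apply: pairing_le => // x; rewrite cfunZE cfun1E mulr1 lerNl.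
  by rewrite (le_trans _ (cfun_norm_ub f x))// -normrN ler_norm.
move: b1 b2; rewrite !pairingZ// lim_m1 !mulr1 => b1 b2.
by rewrite ler_norml b1 b2.
Qed.

Lemma lim_m_between n (f g : cfun (X n)) k0 a b :
  (forall k, (k0 <= k)%N -> forall x,
     a * opprod L k n g x <= opprod L k n f x <= b * opprod L k n g x) ->
  a * pairing g (lim_m L n) <= pairing f (lim_m L n) <= b * pairing g (lim_m L n).
Proof.
move=> H.
have cg (c : R) : c * evaluation g k @[k --> \oo] --> c * pairing g (lim_m L n).
  exact: cvgM (cvg_cst _) (@evaluation_cvg n g).
apply/andP; split.
- apply: ler_cvg_to (cg a) (@evaluation_cvg n f) _.
  near=> k; rewrite /evaluation mulrA ler_wpM2r//.
    by rewrite invr_ge0 ltW// (opprod1_gt0 kappa_ge1 L_adm).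
  have k0k : (k0 <= k)%N by near: k; exact: nbhs_infty_ge.
  by have /andP[] := H k k0k point.
- apply: ler_cvg_to (@evaluation_cvg n f) (cg b) _.
  near=> k; rewrite /evaluation mulrA ler_wpM2r//.
    by rewrite invr_ge0 ltW// (opprod1_gt0 kappa_ge1 L_adm).
  have k0k : (k0 <= k)%N by near: k; exact: nbhs_infty_ge.
  by have /andP[] := H k k0k point.
Unshelve. all: by end_near. Qed.

Let is_lambdaP n : is_lambda L n (pairing (L n cfun1) (lim_m L (succ n))).
Proof.
by move=> s sP; have [_ H] := lim_mP (succ n); exact: H sP (L n cfun1).
Qed.

(** The quotient that defines lambda_n is the one that defines m_(n+1), taken at
    the function L_n 1. *)
Lemma lim_lambdaE n : lim_lambda L n = pairing (L n cfun1) (lim_m L (succ n)).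
Proof.
have H : is_lambda L n (lim_lambda L n).
  apply: (xgetPex (0 : R)).
  by exists (pairing (L n cfun1) (lim_m L (succ n))); exact: is_lambdaP.
pose s m : borel_measure (X m) := point_mass point.
have sP : test_measures s by move=> m; exact: point_mass_fin_pos.
exact: (cvgR_unique (H s sP) (is_lambdaP sP)).
Qed.

Lemma lim_lambda_gt0 n : 0 < lim_lambda L n.
Proof.
rewrite lim_lambdaE; apply: (@lt_le_trans _ _ kappa^-1).
  by rewrite invr_gt0 (lt_le_trans ltr01).
rewrite -[leLHS]mulr1 -(lim_m1 (succ n)) -pairingZ; last exact: lim_m_fin_pos.
apply: pairing_le => [|x]; first exact: lim_m_fin_pos.
by rewrite cfunZE cfun1E mulr1; have /andP[] := op1_bounds L_adm x.
Qed.

Lemma lim_lambda_le n : `|lim_lambda L n| <= kappa.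
Proof.
rewrite lim_lambdaE (le_trans (lim_m_norm _))//; apply: cfun_norm_le => x.
have /andP[lo hi] := op1_bounds L_adm x; rewrite ger0_norm//.
by rewrite (le_trans _ lo)// invr_ge0 (le_trans ler01).
Qed.

(** The quotient of f at n over k + 1 steps is the ratio of the quotients of
    L_n f and L_n 1 at n + 1 over k steps. *)
Lemma lim_m_op n f :
  pairing (L n f) (lim_m L (succ n)) = lim_lambda L n * pairing f (lim_m L n).
Proof.
have l0 := lim_lambda_gt0 n.
suff -> : pairing f (lim_m L n) =
    pairing (L n f) (lim_m L (succ n)) / lim_lambda L n.
  by rewrite mulrCA divff ?mulr1// gt_eqF.
have lN0 : pairing (L n cfun1) (lim_m L (succ n)) != 0.
  by rewrite -lim_lambdaE gt_eqF.
rewrite lim_lambdaE; apply: (@cvgR_unique R (fun k => evaluation f k.+1)).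
  by rewrite (cvg_shiftS (evaluation f)); exact: evaluation_cvg.
have -> : (fun k => evaluation f k.+1) =
    (fun k => evaluation (L n f) k / evaluation (L n cfun1) k).
  apply/funext => k; rewrite /evaluation /=.
  have N0 : opprod L k (succ n) cfun1 point != 0.
    by rewrite gt_eqF// (opprod1_gt0 kappa_ge1 L_adm).
  by rewrite invf_div mulrA mulfVK.
exact: cvgM (@evaluation_cvg _ _) (cvgV lN0 (@evaluation_cvg _ _)).
Qed.

End limit_measure.

(** * From exponential approximation to local Hölder continuity *)

Section holder_from_scales.
Context {R : realType} {T : Type} {V : normedZmodType R}.

(** With q ^ a = t, an error t ^ j at scale q ^ j is an error d ^ a at scale d. *)
Lemma locally_holder_of_scales (S : set T) (d : T -> T -> \bar R) (F : T -> V)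
    (t q C : R) : 0 < t < 1 -> 0 < q <= t -> 0 <= C ->
  (forall y z, S y -> S z -> (0 <= d y z)%E) ->
  (forall y z, S y -> S z -> `|F y - F z| <= C) ->
  (forall j y z, S y -> S z -> (d y z <= (q ^+ j)%:E)%E ->
     `|F y - F z| <= C * t ^+ j) ->
  locally_holder S d F.
Proof.
move=> /andP[t0 t1] /andP[q0 qt] C0 d0 FC Fj x Sx.
have q1 : q < 1 by exact: le_lt_trans t1.
have lnq : ln q < 0 by rewrite ln_lt0// q0.
have lnt : ln t < 0 by rewrite ln_lt0// t0.
pose a := ln t / ln q.
have a0 : 0 < a by rewrite /a -divrNN divr_gt0// oppr_gt0.
have a1 : a <= 1.
  by rewrite /a ler_ndivrMr// mul1r ler_ln ?posrE.
have qa : q `^ a = t.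
  by rewrite /powR gt_eqF// /a divfK ?lt_eqF// lnK// posrE.
have C1 : C <= C / t + 1.
  rewrite -[leLHS]addr0 lerD//.
  by rewrite ler_pdivlMr// ler_piMr// ltW.
have C1_gt0 : 0 < C / t + 1 by rewrite ltr_wpDl// divr_ge0// ltW.
(* the division by t makes up for the gap between q ^ (j + 1) and q ^ j, and the
   constant has to be positive in order to cover pairs at infinite distance *)
exists 1, (C / t + 1), a; split => //; [exact: ltW|by rewrite a0 a1|].
move=> y z Sy Sz _ _; have := FC y z Sy Sz; have := fun j => Fj j y z Sy Sz.
have := d0 y z Sy Sz; case: (d y z) => [e| |] //; last first.
  by move=> _ _ _; rewrite poweRyr ?gt_eqF// gt0_muley ?leey// lte_fin.
rewrite lee_fin le_eqVlt => /orP[/eqP <-|e0] H HC.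
  suff : `|F y - F z| <= 0 by rewrite poweR_EFin powR0 ?gt_eqF// mule0 lee_fin.
  apply/ler_addgt0Pl => eps eps0; rewrite addr0.
  have [j je] := geometric_le C (introT andP (conj t0 t1)) eps0.
  by apply: le_trans je; apply: H => //; rewrite lee_fin exprn_ge0// ltW.
rewrite poweR_EFin -EFinM lee_fin.
have powa u v : 0 <= u -> 0 <= v -> u <= v -> u `^ a <= v `^ a.
  by move=> u0 v0; apply: ge0_ler_powR; rewrite ?nnegrE// ltW.
have [e1|e1] := leP 1 e.
  rewrite (le_trans HC)// (le_trans C1)// ler_peMr ?(ltW C1_gt0)//.
  by have := powa 1 e ler01 (ltW e0) e1; rewrite powR1.
(* the scale of e: the j with q ^ (j + 1) < e <= q ^ j *)
have exj : exists j, q ^+ j < e.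
  have [j je] := geometric_le 2 (introT andP (conj q0 q1)) e0.
  by exists j; rewrite (lt_le_trans _ je)// ltr_pMl ?exprn_gt0// ltr1n.
case: (ex_minnP exj) => [[|j]]; first by rewrite expr0 ltNge ltW.
move=> je jmin; have {}jmin : e <= q ^+ j.
  by rewrite leNgt; apply/negP => /jmin; rewrite ltnn.
apply: le_trans (H j _) _; first by rewrite lee_fin.
have tj : t ^+ j.+1 <= e `^ a.
  rewrite -qa -powR_mulrn ?powR_ge0// -powRrM mulrC powRrM powR_mulrn ?(ltW q0)//.
  by rewrite powa// ltW// exprn_gt0.
apply: (@le_trans _ _ (C / t * e `^ a)).
  have -> : C * t ^+ j = C / t * t ^+ j.+1.
    by rewrite exprS mulrA divfK// gt_eqF.
  by apply: ler_wpM2l => //; rewrite divr_ge0// ltW.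
by rewrite ler_wpM2r ?powR_ge0// lerDl.
Qed.

End holder_from_scales.

(** * Perturbation of products and of the limit measures *)

Section distance.
Context {R : realType} {I : choiceType} {succ : I -> I} {modulus : I -> nat}.
Variables (X : I -> compactMetricType R) (Lam : forall n, set (cfun (X n))).
Arguments Lam : clear implicits.
Variables (kappa Delta : R) (tau : nat).
Variables L L' : opseq succ X.
Hypothesis L_adm : admissible Lam kappa Delta tau L.

Lemma norm_cfun1 n : `|cfun1 : cfun (X n)| = 1.
Proof.
apply/eqP; rewrite eq_le; apply/andP; split.
  by apply: cfun_norm_le => x; rewrite cfun1E normr1.
by have := cfun_norm_ub (cfun1 : cfun (X n)) point; rewrite cfun1E normr1.
Qed.

Lemma opnorm_ge0 n (A : cfun (X n) -> cfun (X (succ n))) :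
  (0 <= opnorm (Lam n) A)%E.
Proof.
apply: (@le_trans _ _ (`|A cfun1|%:E)); first by rewrite lee_fin.
by apply: ereal_sup_ubound; exists cfun1 => //; split;
  [exact: cone1 L_adm _|exact: norm_cfun1].
Qed.

Let term_ge0 n :
  (0 <= (2 ^- modulus n)%:E * opnorm (Lam n) (fun f => L n f - L' n f)%R)%E.
Proof. by rewrite mule_ge0 ?opnorm_ge0// lee_fin invr_ge0 exprn_ge0. Qed.

Lemma opdist_ge0 : (0 <= opdist modulus Lam L L')%E.
Proof. by apply: esum_ge0. Qed.

(** A single term of the sum defining the distance, with its weight undone; the
    operator norm over the unit sphere of the cone extends to the cone by
    homogeneity. *)
Lemma opdist_op_le (e : R) n f : (opdist modulus Lam L L' <= e%:E)%E -> Lam n f ->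
  `|L n f - L' n f| <= 2 ^+ modulus n * e * `|f|.
Proof.
move=> de nf.
have [x fx] := cone_pos_point L_adm nf.
have f0 : 0 < `|f|.
  by rewrite (lt_le_trans fx)// (le_trans (ler_norm _))// cfun_norm_ub.
pose g := `|f|^-1 *: f.
have ng : Lam n g by apply: (coneZ L_adm) => //; rewrite invr_gt0.
have g1 : `|g| = 1 by rewrite normrZ normfV normr_id mulVf// gt_eqF.
have fE : f = `|f| *: g by rewrite scalerA divff ?scale1r// gt_eqF.
have -> : L n f - L' n f = `|f| *: (L n g - L' n g).
  have LZ (M : opseq succ X) : M n f = `|f| *: M n g by rewrite -linearZ_LR -fE.
  by rewrite [L n f]LZ [L' n f]LZ; apply: cfunP => y; rewrite !cfunE; ring.
rewrite normrZ normr_id mulrC ler_wpM2r//.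
rewrite -ler_pdivrMl ?exprn_gt0// -lee_fin; apply: le_trans de.
apply: le_trans (esum_ge (x := ((2 ^- modulus n)%:E *
    opnorm (Lam n) (fun f => L n f - L' n f)%R)%E) _); last first.
  exists [set n]; last by rewrite fsbig_set1.
  by split => //; exact: finite_set1.
rewrite EFinM; apply: lee_wpmul2l; first by rewrite lee_fin invr_ge0 exprn_ge0.
by apply: ereal_sup_ubound; exists g.
Qed.

End distance.

Section perturbation.
Context {R : realType} {I : choiceType} {succ : I -> I} {modulus : I -> nat}.
Hypothesis modulus_succ : forall n, (modulus (succ n) <= (modulus n).+1)%N.
Variables (X : I -> compactMetricType R) (Lam : forall n, set (cfun (X n))).
Arguments Lam : clear implicits.
Variables (kappa Delta : R) (tau : nat).
Hypotheses (kappa_ge1 : 1 <= kappa) (Delta_gt0 : 0 < Delta).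
Variables L L' : opseq succ X.
Hypothesis L_adm : admissible Lam kappa Delta tau L.
Hypothesis L'_adm : admissible Lam kappa Delta tau L'.
Local Notation block := tau.+1.
Local Notation D := (distortion Delta).
Local Notation rate := (rate Delta).

Let kappa_gt0 : 0 < kappa. Proof. exact: lt_le_trans kappa_ge1. Qed.
Let kappa_ge0 : 0 <= kappa. Proof. exact: ltW. Qed.

Section fixed_distance.
Variable e : R.
Hypothesis e_ge0 : 0 <= e.
Hypothesis L_L'_close : (opdist modulus Lam L L' <= e%:E)%E.

(** Telescoping from the first operator:
    L^(k+1) f - L'^(k+1) f = L^k (L f - L' f) + (L^k - L'^k)(L' f).
    In the first term L^k acts outside the cone, where its norm is still at most
    kappa^k by positivity; in the second, L' f is in the cone. *)
Lemma opprod_close k n f : Lam n f ->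
  `|opprod L k n f - opprod L' k n f| <=
    2 ^+ modulus n * (4 * kappa) ^+ k * e * `|f|.
Proof.
elim: k n f => [|k IH] n f nf /=.
  by rewrite subrr normr0 mulr_ge0// mulr_ge0// mulr_ge0// exprn_ge0// mulr_ge0.
have nLf : Lam (succ n) (L' n f) by exact: (op_cone L'_adm).
rewrite -(subrK (opprod L k (succ n) (L' n f)) (opprod L k (succ n) (L n f))).
rewrite -addrA -(opprodB L) (le_trans (ler_normD _ _))//.
have h1 : `|opprod L k (succ n) (L n f - L' n f)| <=
    kappa ^+ k * (2 ^+ modulus n * e * `|f|).
  apply: le_trans (norm_opprod_le kappa_ge1 L_adm k _) _.
  apply: ler_wpM2l; first exact: exprn_ge0.
  by have H := opdist_op_le L_adm L_L'_close nf; exact H.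
have h2 : `|opprod L k (succ n) (L' n f) - opprod L' k (succ n) (L' n f)| <=
    2 ^+ (modulus n).+1 * (4 * kappa) ^+ k * e * (kappa * `|f|).
  apply: le_trans (IH _ _ nLf) _.
  have c0 : 0 <= (4 * kappa) ^+ k by rewrite exprn_ge0// mulr_ge0.
  apply: ler_pM => //.
  - by rewrite mulr_ge0// mulr_ge0// exprn_ge0.
  - apply: ler_wpM2r => //; apply: ler_wpM2r => //.
    by rewrite ler_weXn2l ?ler1n.
  - by have := norm_opprod_le kappa_ge1 L'_adm 1 f; rewrite expr1.
rewrite (le_trans (lerD h1 h2))//.
have M0 : 0 <= 2 ^+ modulus n * e * `|f| by rewrite mulr_ge0// mulr_ge0// exprn_ge0.
set M := 2 ^+ modulus n in M0 *; set F := `|f| in M0 *.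
have -> : kappa ^+ k * (M * e * F) +
    2 ^+ (modulus n).+1 * (4 * kappa) ^+ k * e * (kappa * F) =
    M * e * F * (kappa ^+ k + 2 * kappa * (4 * kappa) ^+ k).
  by rewrite exprS -/M; ring.
have -> : M * (4 * kappa) ^+ k.+1 * e * F =
    M * e * F * (4 * kappa * (4 * kappa) ^+ k) by rewrite exprS; ring.
apply: ler_wpM2l => //.
have : kappa ^+ k <= kappa * (4 * kappa) ^+ k.
  rewrite exprMn mulrA ler_peMl ?exprn_ge0//.
  by rewrite mulr_ege1// exprn_ege1// ler1n.
have : 0 <= kappa * (4 * kappa) ^+ k by rewrite mulr_ge0// exprn_ge0// mulr_ge0.
lra.
Qed.

(** Both limits are compared with the quotient of the products of k operators at
    one point: the contraction controls the passage to the limit, and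
    [opprod_close] the difference of the two quotients. *)
Lemma lim_m_close n f j k : (j.+1 * block <= k)%N -> Lam n f ->
  `|pairing f (lim_m L n) - pairing f (lim_m L' n)| <=
    `|f| * (2 * D * rate ^+ j + 2 * 2 ^+ modulus n * (4 * kappa ^+ 2) ^+ k * e).
Proof.
move=> jk nf; have n1 := cone1 L_adm n.
have approx (M : opseq succ X) : admissible Lam kappa Delta tau M ->
    `|pairing f (lim_m M n) - opprod M k n f point / opprod M k n cfun1 point| <=
      D * rate ^+ j * `|f|.
  move=> M_adm.
  have [a [b [a0 ab ba H]]] := projective_squeeze M_adm Delta_gt0 j nf n1.
  have := lim_m_between kappa_ge1 Delta_gt0 M_adm H.
  rewrite (lim_m1 kappa_ge1 Delta_gt0 M_adm) !mulr1 => /andP[am mb].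
  have g0 : 0 < opprod M k n cfun1 point by exact: (opprod1_gt0 kappa_ge1 M_adm).
  have := H k jk point; rewrite -(ler_pdivlMr _ _ g0) => /andP[aq].
  rewrite -(ler_pdivrMr _ _ g0) => qb.
  have af : a <= `|f|.
    apply: le_trans am (le_trans (ler_norm _) _).
    exact: (lim_m_norm kappa_ge1 Delta_gt0 M_adm).
  apply: (@le_trans _ _ (b - a)); first by rewrite ler_norml; apply/andP; split; lra.
  apply: le_trans ba _; apply: ler_wpM2l => //; rewrite mulr_ge0//.
    by rewrite ltW// (lt_trans ltr01)// distortion_gt1.
  by rewrite exprn_ge0// ltW// rate_gt0.
have hL := approx L L_adm; have hL' := approx L' L'_adm.
set P := opprod L k n f point in hL; set Q := opprod L k n cfun1 point in hL.
set P' := opprod L' k n f point in hL'; set Q' := opprod L' k n cfun1 point in hL'.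
pose E := 2 ^+ modulus n * (4 * kappa) ^+ k * e.
have Q0 : 0 < Q by exact: (opprod1_gt0 kappa_ge1 L_adm).
have Q'0 : 0 < Q' by exact: (opprod1_gt0 kappa_ge1 L'_adm).
have PP' : `|P - P'| <= E * `|f|.
  exact: le_trans (cfun_norm_ub (opprod L k n f - opprod L' k n f) point)
    (opprod_close k nf).
have QQ' : `|Q - Q'| <= E.
  have := opprod_close k n1; rewrite norm_cfun1 mulr1; apply: le_trans.
  exact: (cfun_norm_ub (opprod L k n cfun1 - opprod L' k n cfun1) point).
have P'Q' : `|P'| <= `|f| * Q'.
  by have H := opprod_norm L'_adm f (point : X (advance succ k n)); exact H.
have QV : Q^-1 <= kappa ^+ k.
  rewrite -[leRHS]invrK lef_pV2 ?posrE ?invr_gt0 ?exprn_gt0//.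
  by have /andP[] := opprod1_bounds kappa_ge1 L_adm (point : X (advance succ k n)).
have qq : `|P / Q - P' / Q'| <= 2 * kappa ^+ k * E * `|f|.
  have -> : P / Q - P' / Q' = ((P - P') - P' / Q' * (Q - Q')) / Q.
    by field; rewrite !gt_eqF.
  rewrite normrM [`|Q^-1|]gtr0_norm ?invr_gt0//.
  have E0 : 0 <= E by exact: le_trans QQ'.
  have h : `|P - P' - P' / Q' * (Q - Q')| <= 2 * E * `|f|.
    apply: le_trans (ler_normB _ _) _.
    have : `|P' / Q' * (Q - Q')| <= `|f| * E.
      rewrite normrM; apply: ler_pM => //.
      by rewrite normrM normfV (gtr0_norm Q'0) ler_pdivrMr.
    lra.
  apply: (@le_trans _ _ (2 * E * `|f| * kappa ^+ k)); last by lra.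
  by apply: ler_pM => //; rewrite invr_ge0 ltW.
have -> : `|f| * (2 * D * rate ^+ j +
    2 * 2 ^+ modulus n * (4 * kappa ^+ 2) ^+ k * e) =
    2 * (D * rate ^+ j * `|f|) + 2 * kappa ^+ k * E * `|f|.
  have -> : (4 * kappa ^+ 2) ^+ k = kappa ^+ k * (4 * kappa) ^+ k.
    by rewrite -exprMn; congr (_ ^+ _); ring.
  by rewrite /E; ring.
have H := ler_dist_approx hL hL' qq; exact H.
Qed.

End fixed_distance.
End perturbation.

(** * Hölder continuity of the limit measures and of the multipliers *)

Section holder_measure.
Context {R : realType} {I : choiceType} {succ : I -> I} {modulus : I -> nat}.
Hypothesis modulus_succ : forall n, (modulus (succ n) <= (modulus n).+1)%N.
Variables (X : I -> compactMetricType R) (Lam : forall n, set (cfun (X n))).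
Arguments Lam : clear implicits.
Variables (kappa Delta : R) (tau : nat).
Hypotheses (kappa_ge1 : 1 <= kappa) (Delta_gt0 : 0 < Delta).
Local Notation block := tau.+1.
Local Notation D := (distortion Delta).
Local Notation rate := (rate Delta).

Let kappa_gt0 : 0 < kappa. Proof. exact: lt_le_trans kappa_ge1. Qed.

(** Growth over one block of the error caused by perturbing operators: a factor
    4 kappa per step for the product, kappa for dividing by L^k 1, and 2 for the
    weights of the distance when products start k steps in the past. *)
Definition growth : R := (8 * kappa ^+ 2) ^+ block.

(** Chosen so that an error scale ^ j, amplified over j + 1 blocks, is at most a
    constant times rate ^ j; see [growth_scale]. *)
Definition scale : R := rate / growth.

Lemma growth_ge1 : 1 <= growth.
Proof.
rewrite exprn_ege1// mulr_ege1 ?ler1n// exprn_ege1//.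
Qed.

Let growth_gt0 : 0 < growth. Proof. exact: lt_le_trans growth_ge1. Qed.

Lemma scale_bounds : 0 < scale <= rate.
Proof.
rewrite divr_gt0 ?rate_gt0//= ler_pdivrMr// ler_peMr ?growth_ge1//.
by rewrite ltW// rate_gt0.
Qed.

Lemma rate_bounds : 0 < rate < 1.
Proof. by rewrite rate_gt0// rate_lt1. Qed.

Lemma growth_scale j : (8 * kappa ^+ 2) ^+ (j.+1 * block) * scale ^+ j =
  growth * rate ^+ j.
Proof.
rewrite mulnC exprM -/growth /scale exprMn exprVn exprS.
by rewrite -mulrA [growth ^+ j * _]mulrCA divff ?mulr1// expf_neq0// gt_eqF.
Qed.

Definition measure_modulus n : R := 2 * D + 2 * 2 ^+ modulus n * growth.

Lemma measure_modulus_ge0 n : 0 <= measure_modulus n.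
Proof.
have D0 : 0 <= D by rewrite ltW// (lt_trans ltr01)// distortion_gt1.
apply: addr_ge0; first exact: mulr_ge0.
by apply: mulr_ge0; [rewrite mulr_ge0// exprn_ge0|exact: ltW].
Qed.

Section two_sequences.
Variables L L' : opseq succ X.
Hypothesis L_adm : admissible Lam kappa Delta tau L.
Hypothesis L'_adm : admissible Lam kappa Delta tau L'.
Variable j : nat.
Hypothesis L_L'_close : (opdist modulus Lam L L' <= (scale ^+ j)%:E)%E.

Let scale_ge0 : 0 <= scale. Proof. by have /andP[/ltW] := scale_bounds. Qed.
Let rate_ge0 : 0 <= rate. Proof. by have /andP[/ltW] := rate_bounds. Qed.

Lemma lim_m_scale n f : Lam n f ->
  `|pairing f (lim_m L n) - pairing f (lim_m L' n)| <=
    `|f| * measure_modulus n * rate ^+ j.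
Proof.
move=> nf; apply: le_trans (lim_m_close modulus_succ kappa_ge1 Delta_gt0 L_adm
  L'_adm (exprn_ge0 j scale_ge0) L_L'_close (leqnn _) nf) _.
rewrite -(mulrA `|f|); apply: ler_wpM2l => //.
rewrite /measure_modulus [leRHS]mulrDl; apply: lerD => //.
rewrite -[leLHS]mulrA -[leRHS]mulrA; apply: ler_wpM2l; first by rewrite mulr_ge0// exprn_ge0.
rewrite -growth_scale; apply: ler_wpM2r; first exact: exprn_ge0.
apply: lerXn2r; rewrite ?nnegrE ?mulr_ge0 ?exprn_ge0 ?(ltW kappa_gt0)//.
by rewrite ler_wpM2r ?exprn_ge0 ?(ltW kappa_gt0)// ler_nat.
Qed.

(** lambda_n = m_(n+1)(L_n 1), where both the measure and the function vary. *)
Lemma lim_lambda_scale n : `|lim_lambda L n - lim_lambda L' n| <=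
  (kappa * measure_modulus (succ n) + 2 ^+ modulus n) * rate ^+ j.
Proof.
rewrite (lim_lambdaE kappa_ge1 Delta_gt0 L_adm).
rewrite (lim_lambdaE kappa_ge1 Delta_gt0 L'_adm).
rewrite -(subrK (pairing (L n cfun1) (lim_m L' (succ n)))
  (pairing (L n cfun1) (lim_m L (succ n)))).
rewrite -addrA (le_trans (ler_normD _ _))// mulrDl lerD//.
- have n1 : Lam (succ n) (L n cfun1) by apply: (op_cone L_adm); exact: cone1 L_adm _.
  apply: le_trans (lim_m_scale n1) _; rewrite -!mulrA; apply: ler_wpM2r.
    by rewrite mulr_ge0 ?measure_modulus_ge0 ?exprn_ge0.
  by have := norm_opprod_le kappa_ge1 L_adm 1 (cfun1 : cfun (X n)); rewrite norm_cfun1 mulr1 expr1.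
- rewrite -pairingB; last exact: lim_m_fin_pos kappa_ge1 Delta_gt0 L'_adm _.
  apply: le_trans (lim_m_norm kappa_ge1 Delta_gt0 L'_adm _) _.
  have H := opdist_op_le L_adm L_L'_close (cone1 L_adm n).
  rewrite norm_cfun1 mulr1 in H; apply: (le_trans H).
  apply: ler_wpM2l; first exact: exprn_ge0.
  apply: lerXn2r; rewrite ?nnegrE//.
  by have /andP[] := scale_bounds.
Qed.

End two_sequences.

Let dist_ge0 (y z : opseq succ X) : admissible Lam kappa Delta tau y ->
  admissible Lam kappa Delta tau z -> (0 <= opdist modulus Lam y z)%E.
Proof. by move=> yA _; exact: opdist_ge0 yA. Qed.

Lemma lim_m_locally_holder n f : Lam n f ->
  locally_holder (admissible Lam kappa Delta tau) (opdist modulus Lam)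
    (fun L : opseq succ X => pairing f (lim_m L n)).
Proof.
move=> nf; set C := `|f| * measure_modulus n + 2 * `|f|.
have C0 : 0 <= `|f| * measure_modulus n by rewrite mulr_ge0// measure_modulus_ge0.
apply: (@locally_holder_of_scales _ _ _ _ _ _ rate scale C) => //.
- exact: rate_bounds.
- exact: scale_bounds.
- by rewrite addr_ge0// mulr_ge0.
- move=> y z yA zA; rewrite (le_trans (ler_normB _ _))// /C.
  apply: (@le_trans _ _ (2 * `|f|)); last by rewrite lerDr.
  by rewrite mulr_natl mulr2n; apply: lerD;
    [exact: (lim_m_norm kappa_ge1 Delta_gt0 yA)|exact: (lim_m_norm kappa_ge1 Delta_gt0 zA)].
- move=> j y z yA zA yz; apply: le_trans (lim_m_scale yA zA yz nf) _.
  apply: ler_wpM2r; first by rewrite exprn_ge0//; have /andP[/ltW] := rate_bounds.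
  by rewrite lerDl mulr_ge0.
Qed.

Lemma lim_lambda_locally_holder n :
  locally_holder (admissible Lam kappa Delta tau) (opdist modulus Lam)
    (fun L : opseq succ X => lim_lambda L n).
Proof.
set C0 := kappa * measure_modulus (succ n) + 2 ^+ modulus n.
have C00 : 0 <= C0.
  by rewrite addr_ge0 ?exprn_ge0// mulr_ge0 ?measure_modulus_ge0// ltW.
apply: (@locally_holder_of_scales _ _ _ _ _ _ rate scale (C0 + 2 * kappa)) => //.
- exact: rate_bounds.
- exact: scale_bounds.
- by rewrite addr_ge0// mulr_ge0// ltW.
- move=> y z yA zA; rewrite (le_trans (ler_normB _ _))//.
  apply: (@le_trans _ _ (2 * kappa)); last by rewrite lerDr.
  by rewrite mulr_natl mulr2n; apply: lerD;
    [exact: (lim_lambda_le kappa_ge1 Delta_gt0 yA)|exact: (lim_lambda_le kappa_ge1 Delta_gt0 zA)].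
- move=> j y z yA zA yz; apply: le_trans (lim_lambda_scale yA zA yz n) _.
  apply: ler_wpM2r; first by rewrite exprn_ge0//; have /andP[/ltW] := rate_bounds.
  by rewrite lerDl mulr_ge0// ltW.
Qed.

End holder_measure.

(** * The limit densities *)

Section long_products.
Context {R : realType} {I : choiceType} {succ : I -> I}.
Variables (X : I -> compactMetricType R) (Lam : forall n, set (cfun (X n))).
Arguments Lam : clear implicits.
Variables (kappa Delta : R) (tau : nat).
Variable L : opseq succ X.
Hypotheses (kappa_ge1 : 1 <= kappa) (Delta_gt0 : 0 < Delta).
Hypothesis L_adm : admissible Lam kappa Delta tau L.
Local Notation block := tau.+1.
Local Notation D := (distortion Delta).

Definition harnack : R := (1 + D) * kappa ^+ block * kappa ^+ block.

Let D_ge0 : 0 <= D.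
Proof. by rewrite ltW// (lt_trans ltr01)// distortion_gt1. Qed.

Lemma harnack_gt0 : 0 < harnack.
Proof.
have k0 : 0 < kappa ^+ block by rewrite exprn_gt0// (lt_le_trans ltr01).
by rewrite mulr_gt0// mulr_gt0// ltr_pwDl.
Qed.

(** The last block makes the function comparable to the image of 1 under that
    block, which lies between kappa^-block and kappa^block. *)
Lemma opprod_harnack k n f : (block <= k)%N -> Lam n f ->
  forall x y, opprod L k n f x <= harnack * opprod L k n f y.
Proof.
move=> bk nf; rewrite -(subnK bk).
apply: (@opprod_add _ _ _ _ _ (k - block) block n
  (fun m A => forall x y, A f x <= harnack * A f y)).
have := opprod_cone L_adm (k - block) nf.
move: (opprod L (k - block) n f); move: (advance succ (k - block) n) => l g ng.
have [a [b [a0 ab]]] := projective_squeeze L_adm Delta_gt0 0 ng (cone1 L_adm l).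
rewrite expr0 mulr1 mul1n => ba H x y.
have /andP[_ gx] := H block (leqnn _) x; have /andP[gy _] := H block (leqnn _) y.
have k0 : 0 < kappa ^+ block by rewrite exprn_gt0// (lt_le_trans ltr01).
have /andP[_ x1] := opprod1_bounds kappa_ge1 L_adm x.
have /andP[y1 _] := opprod1_bounds kappa_ge1 L_adm y.
apply: (le_trans gx); apply: (@le_trans _ _ ((1 + D) * a * kappa ^+ block)).
  apply: ler_pM => //; [by rewrite (le_trans (ltW a0))| |by lra].
  exact: ltW (opprod1_gt0 kappa_ge1 L_adm _).
rewrite /harnack -!mulrA; apply: ler_wpM2l; first by rewrite addr_ge0.
rewrite mulrC; apply: ler_wpM2l; first exact: ltW.
apply: le_trans (ler_wpM2l (ltW k0) gy); rewrite mulrCA ler_peMr ?(ltW a0)//.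
by rewrite -ler_pdivrMl// mulr1.
Qed.

Lemma lim_m_opprod k n f : pairing (opprod L k n f) (lim_m L (advance succ k n)) =
  (\prod_(i < k) lim_lambda L (advance succ i n)) * pairing f (lim_m L n).
Proof.
elim: k n f => [|k IH] n f /=; first by rewrite big_ord0 mul1r.
rewrite IH big_ord_recl (lim_m_op kappa_ge1 Delta_gt0 L_adm) /=.
by rewrite mulrA [_ * lim_lambda L n]mulrC.
Qed.

End long_products.

Section uniform_limits.
Context {R : realType} {X : compactMetricType R}.

Lemma cfun_cvg_of_cauchy (u : nat -> cfun X) :
  (forall e, 0 < e -> exists k0, forall k l, (k0 <= k)%N -> (k0 <= l)%N ->
     `|u k - u l| <= e) ->
  exists h : cfun X, u k @[k --> \oo] --> h.
Proof.
move=> uC.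
have pt x : exists l : R, u k x @[k --> \oo] --> l.
  apply: cvg_of_cauchy => e /uC[k0 H]; exists (u k0 x), k0 => k k0k.
  exact: le_trans (cfun_norm_ub (u k - u k0) x) (H k k0 k0k (leqnn _)).
have [h hP] := choice pt.
have uh e : 0 < e -> exists k0, forall k, (k0 <= k)%N -> forall x, `|u k x - h x| <= e.
  move=> e0; have [k0 H] := uC _ e0; exists k0 => k k0k x.
  have uk : `|u k x - u l x| @[l --> \oo] --> `|u k x - h x|.
    by apply: cvg_norm; apply: cvgB; [exact: cvg_cst|exact: hP].
  apply: ler_cvg_to uk (cvg_cst e) _; near=> l.
  apply: le_trans (cfun_norm_ub (u k - u l) x) _; apply: H => //.
  by near: l; exact: nbhs_infty_ge.
have hC : continuous h.
  move=> x; apply/cvgrPdist_le => e e0.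
  have e3 : 0 < e / 3 by rewrite divr_gt0.
  have [k0 H] := uh _ e3; have := H k0 (leqnn _) x => Hx.
  have /cvgrPdist_le/(_ _ e3) := @cfun_cont _ _ (u k0) x.
  apply: filterS => y Hy; have := H k0 (leqnn _) y; move: Hx Hy.
  rewrite !ler_norml => /andP[? ?] /andP[? ?] /andP[? ?].
  by apply/andP; split; lra.
exists (mkcts hC); apply/cvgrPdist_le => e /uh[k0 H].
near=> k; apply: cfun_norm_le => x; rewrite cfunBE distrC; apply: H.
by near: k; exact: nbhs_infty_ge.
Unshelve. all: by end_near. Qed.

End uniform_limits.

Section casts.
Context {R : realType} {X : int -> compactMetricType R}.

Lemma cfun_cast_ind (P : forall m, cfun (X m) -> Prop) i j (e : i = j) f :
  P i f -> P j (cfun_cast X e f).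
Proof. by case: _ / e. Qed.

Lemma cfun_cast_ind2 (P : forall m, cfun (X m) -> cfun (X m) -> Prop)
  i j (e : i = j) f g : P i f g -> P j (cfun_cast X e f) (cfun_cast X e g).
Proof. by case: _ / e. Qed.

End casts.

(** If s is between a t and b t, and their normalizers S and T compare likewise,
    then the normalized values differ relatively by at most b/a - 1. *)
Lemma ratio_close {R : realFieldType} (a b c s t S T : R) :
  0 < a -> a <= b -> b - a <= c * a -> 0 <= t -> 0 < S -> 0 < T ->
  a * t <= s <= b * t -> a * T <= S <= b * T ->
  `|s / S - t / T| <= c * (t / T).
Proof.
move=> a0 ab bac t0 S0 T0 /andP[ats sbt] /andP[aTS SbT].
have b0 : 0 < b by exact: lt_le_trans ab.
have c0 : 0 <= c by rewrite -(pmulr_lge0 _ a0) (le_trans _ bac)// subr_ge0.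
pose q := t / T; have tE : t = q * T by rewrite divfK// gt_eqF.
have q0 : 0 <= q by rewrite divr_ge0// ltW.
pose p := s / S; have sE : s = p * S by rewrite divfK// gt_eqF.
rewrite -/p -/q ler_norml; apply/andP; split.
- have bp : a * q <= b * p.
    rewrite -(ler_pM2r S0) -[leRHS]mulrA -sE.
    apply: (le_trans (ler_wpM2l (mulr_ge0 (ltW a0) q0) SbT)).
    by have := ler_wpM2l (ltW b0) ats; rewrite tE; lra.
  rewrite -(ler_pM2l b0).
  have := ler_wpM2r q0 bac; have := ler_wpM2l (mulr_ge0 c0 q0) ab; lra.
- have ap : a * p <= b * q.
    rewrite -(ler_pM2r S0) -mulrA -sE.
    apply: le_trans (ler_wpM2l (mulr_ge0 (ltW b0) q0) aTS).
    by have := ler_wpM2l (ltW a0) sbt; rewrite tE; lra.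
  rewrite -(ler_pM2l a0).
  have := ler_wpM2r q0 bac; lra.
Qed.

Section limit_density.
Context {R : realType}.
Variables (X : int -> compactMetricType R) (Lam : forall n, set (cfun (X n))).
Arguments Lam : clear implicits.
Variables (kappa Delta : R) (tau : nat).
Variable L : opseq int_succ X.
Hypotheses (kappa_ge1 : 1 <= kappa) (Delta_gt0 : 0 < Delta).
Hypothesis L_adm : admissible Lam kappa Delta tau L.
Local Notation block := tau.+1.
Local Notation D := (distortion Delta).
Local Notation rate := (rate Delta).
Local Notation K := (harnack kappa Delta tau).

Let D_ge0 : 0 <= D.
Proof. by rewrite ltW// (lt_trans ltr01)// distortion_gt1. Qed.
Let rate_ge0 : 0 <= rate. Proof. by rewrite ltW// rate_gt0. Qed.

Definition pushed k n (f : cfun (X (n - k%:Z))) : cfun (X n) :=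
  cfun_cast X (advance_subK k n) (opprod L k (n - k%:Z) f).

Definition past k n : set (cfun (X n)) := [set pushed f | f in Lam (n - k%:Z)].

Lemma pastI k n l (e : advance int_succ k l = n) f : Lam l f ->
  past k (cfun_cast X e (opprod L k l f)).
Proof.
have lE : l = n - k%:Z by rewrite -e advance_int addrK.
move: e f; rewrite lE => e f nf.
by exists f => //; rewrite /pushed (eq_irrelevance e (advance_subK k n)).
Qed.

(** A function coming from j + k steps in the past also comes from k steps in the
    past, because the first j operators stay in the cones. *)
Lemma past_sub j k n : @past (j + k) n `<=` @past k n.
Proof.
move=> _ [f nf <-]; rewrite /pushed; move: (advance_subK _ _) nf.
move: (n - (j + k)%:Z) f => l f e nf; move: e.
apply: (@opprod_add _ _ _ _ _ j k l
  (fun m A => forall e : m = n, past k (cfun_cast X e (A f)))) => e.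
by apply: pastI; exact: opprod_cone L_adm _ _ _ nf.
Qed.

Section one_time.
Variables (k : nat) (n : int).
Implicit Types w : cfun (X n).

Lemma past_cone w : past k w -> Lam n w.
Proof.
by move=> [f nf <-]; apply: cfun_cast_ind; exact: opprod_cone L_adm _ _ _ nf.
Qed.

Hypothesis block_k : (block <= k)%N.

Lemma past_harnack w : past k w -> forall x y, w x <= K * w y.
Proof.
move=> [f nf <-]; rewrite /pushed.
refine (@cfun_cast_ind R X (fun m (w : cfun (X m)) => forall x y, w x <= K * w y) _ _ _ _ _).
exact: (opprod_harnack kappa_ge1 Delta_gt0 L_adm block_k nf).
Qed.

Definition mass w : R := pairing w (lim_m L n).

Lemma past_le_mass w x : past k w -> w x <= K * mass w.
Proof.
move=> kw; have fin := lim_m_fin_pos kappa_ge1 Delta_gt0 L_adm n.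
rewrite -[leLHS]mulr1 -(lim_m1 kappa_ge1 Delta_gt0 L_adm n) /mass -!pairingZ//.
apply: pairing_le => // y; rewrite !cfunZE cfun1E mulr1.
exact: past_harnack.
Qed.

Lemma past_mass_gt0 w : past k w -> 0 < mass w.
Proof.
move=> kw; have [x wx] := cone_pos_point L_adm (past_cone kw).
have := lt_le_trans wx (past_le_mass x kw).
by rewrite pmulr_rgt0// harnack_gt0.
Qed.

Definition normalized w : cfun (X n) := (mass w)^-1 *: w.

Lemma normalized_ge0 w x : past k w -> 0 <= normalized w x.
Proof.
move=> kw; rewrite mulr_ge0 ?(cone_ge0 L_adm (past_cone kw))//.
by rewrite invr_ge0 ltW// past_mass_gt0.
Qed.

Lemma normalized_le w x : past k w -> normalized w x <= K.
Proof.
move=> kw; rewrite cfunZE mulrC ler_pdivrMr ?past_mass_gt0//.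
exact: past_le_mass.
Qed.

Lemma normalized_norm w : past k w -> `|normalized w| <= K.
Proof.
move=> kw; apply: cfun_norm_le => x; rewrite ger0_norm ?normalized_ge0//.
exact: normalized_le.
Qed.

End one_time.

(** Two functions from a distant past are nearly proportional; dividing by their
    masses fixes the proportionality factor. *)
Lemma normalized_close j k n (w v : cfun (X n)) : (j.+1 * block <= k)%N ->
  past k w -> past k v -> `|normalized w - normalized v| <= K * D * rate ^+ j.
Proof.
move=> jk kw kv.
have bk : (block <= k)%N by rewrite (leq_trans _ jk)// leq_pmull.
have [a [b [a0 ab ba H]]] : exists a b, [/\ 0 < a, a <= b,
    b - a <= D * rate ^+ j * a & forall x, a * v x <= w x <= b * v x].
  move: kw kv => [f nf <-] [g ng <-].
  have [a [b [a0 ab ba H]]] := projective_squeeze L_adm Delta_gt0 j nf ng.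
  exists a, b; split => //; rewrite /pushed.
  refine (@cfun_cast_ind2 R X
    (fun m (w v : cfun (X m)) => forall x, a * v x <= w x <= b * v x) _ _ _ _ _ _).
  exact: H.
have fin := lim_m_fin_pos kappa_ge1 Delta_gt0 L_adm n.
have Mw := past_mass_gt0 bk kw; have Mv := past_mass_gt0 bk kv.
have aM : a * mass v <= mass w.
  by rewrite /mass -pairingZ//; apply: pairing_le => // x; have /andP[] := H x.
have bM : mass w <= b * mass v.
  by rewrite /mass -pairingZ//; apply: pairing_le => // x; have /andP[] := H x.
apply: cfun_norm_le => x; rewrite cfunBE !cfunZE ![_^-1 * _]mulrC.
have Mab : a * mass v <= mass w <= b * mass v by rewrite aM bM.
have v0 := cone_ge0 L_adm (past_cone kv) x.
apply: le_trans (ratio_close a0 ab ba v0 Mw Mv (H x) Mab) _.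
have := normalized_le bk x kv; rewrite cfunZE mulrC => vK.
rewrite -mulrA mulrC; apply: ler_wpM2r => //.
by rewrite mulr_ge0// exprn_ge0.
Qed.

(** The normalizing constant in the definition of h_n is m_n of the pushed
    function, by iteration of the eigenvector equation. *)
Lemma is_h_normalized n k f : Lam (n - k%:Z) f ->
  (\prod_(1 <= j < k.+1) lim_lambda L (n - j%:Z) *
     pairing f (lim_m L (n - k%:Z)))^-1 *:
    cfun_cast X (advance_subK k n) (opprod L k (n - k%:Z) f) =
  normalized (@pushed k n f).
Proof.
move=> nf; congr (_^-1 *: _); rewrite /mass /pushed.
have -> : pairing (cfun_cast X (advance_subK k n) (opprod L k (n - k%:Z) f))
    (lim_m L n) = pairing (opprod L k (n - k%:Z) f)
    (lim_m L (advance int_succ k (n - k%:Z))).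
  exact: (@cfun_cast_ind R X (fun m (w : cfun (X m)) => pairing w (lim_m L m) = _)).
rewrite (lim_m_opprod kappa_ge1 Delta_gt0 L_adm); congr (_ * _).
rewrite big_add1/= big_nat_rev/= big_mkord; apply: eq_bigr => i _.
congr lim_lambda; rewrite advance_int add0n.
have ik := ltn_ord i; rewrite subnSK// -subzn ?(ltnW ik)//.
by rewrite opprB addrCA addrC.
Qed.

Let approx n k : cfun (X n) := normalized (@pushed k n cfun1).

Let past1 k n : past k (@pushed k n cfun1).
Proof. by exists cfun1 => //; exact: cone1 L_adm _. Qed.

Lemma mass_pushed1_inv k n : (mass (@pushed k n cfun1))^-1 <= kappa ^+ k.
Proof.
have k0 : 0 < kappa ^- k.
  by rewrite invr_gt0 exprn_gt0// (lt_le_trans ltr01).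
have lo : kappa ^- k <= mass (@pushed k n cfun1).
  have fin := lim_m_fin_pos kappa_ge1 Delta_gt0 L_adm n.
  rewrite -[leLHS]mulr1 -(lim_m1 kappa_ge1 Delta_gt0 L_adm n) -pairingZ//.
  apply: pairing_le => // x; rewrite cfunZE cfun1E mulr1; move: x.
  refine (@cfun_cast_ind R X (fun m (w : cfun (X m)) => forall x, kappa ^- k <= w x)
    _ _ _ _ _) => x.
  by have /andP[] := opprod1_bounds kappa_ge1 L_adm x.
by rewrite -[leRHS]invrK lef_pV2 ?posrE// (lt_le_trans k0).
Qed.

(** The estimate of [normalized_close] passes to the limit, the constant function
    being pushed from ever more remote times. *)
Lemma is_h_close n h : is_h Lam L n h -> forall j k (w : cfun (X n)),
  (j.+1 * block <= k)%N -> past k w ->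
  `|h - normalized w| <= K * D * rate ^+ j.
Proof.
move=> hP j k w jk kw.
have hA : approx n l @[l --> \oo] --> h.
  have := hP (fun l => cfun1) (fun l => cone1 L_adm l).
  apply: cvg_trans; apply: near_eq_cvg; apply: nearW => l.
  by rewrite is_h_normalized//; exact: cone1 L_adm _.
have hw : `|approx n l - normalized w| @[l --> \oo] --> `|h - normalized w|.
  by apply: cvg_norm; apply: cvgB => //; exact: cvg_cst.
apply: ler_cvg_to hw (cvg_cst _) _; near=> l.
have kl : (k <= l)%N by near: l; exact: nbhs_infty_ge.
apply: normalized_close jk _ kw; apply: (@past_sub (l - k)).
by rewrite subnK//; exact: past1.
Unshelve. all: by end_near. Qed.

Lemma lim_hP n : is_h Lam L n (lim_h Lam L n).
Proof.
have KD0 : 0 <= K * D by rewrite mulr_ge0// ltW// harnack_gt0.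
have small e : 0 < e -> exists j, K * D * rate ^+ j <= e.
  by apply: geometric_le; rewrite rate_gt0// rate_lt1.
apply: (xgetPex (0 : cfun (X n))).
have [e e0|h hP] := @cfun_cvg_of_cauchy R (X n) (approx n).
  have [j je] := small _ e0; exists (j.+1 * block)%N => k l jk jl.
  wlog kl : k l jk jl / (k <= l)%N.
    by move=> wl; case: (leqP k l) => [|/ltnW] kl; [|rewrite distrC]; exact: wl.
  apply: le_trans je; rewrite distrC; apply: normalized_close jk _ (past1 _ _).
  by apply: (@past_sub (l - k)); rewrite subnK//; exact: past1.
exists h => f nf; apply/cvgrPdist_le => e e0.
have e2 : 0 < e / 2 by rewrite divr_gt0.
have [j je] := small _ e2.
move/cvgrPdist_le: hP => /(_ _ e2) hP.
near=> k; rewrite is_h_normalized//.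
have kh : `|h - approx n k| <= e / 2 by near: k.
have jk : (j.+1 * block <= k)%N by near: k; exact: nbhs_infty_ge.
rewrite [e]splitr -(subrK (approx n k) h) -addrA (le_trans (ler_normD _ _))//.
apply: lerD => //; apply: le_trans je; apply: normalized_close jk (past1 _ _) _.
by exists (f (n - k%:Z)).
Unshelve. all: by end_near. Qed.

Lemma lim_h_norm n : `|lim_h Lam L n| <= K * D + K.
Proof.
have := is_h_close (@lim_hP n) (j := 0) (leqnn _) (past1 _ _).
rewrite expr0 mulr1 mul1n => H.
rewrite -[lim_h _ _ _](subrK (approx n block)) (le_trans (ler_normD _ _))// lerD//.
by apply: normalized_norm (past1 _ _).
Qed.

End limit_density.

(** * Hölder continuity of the limit densities *)

Lemma ler_dist3 {R : numDomainType} {V : normedZmodType R} (a b c d : V) :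
  `|a - d| <= `|a - b| + `|b - c| + `|d - c|.
Proof.
rewrite (distrC d) (le_trans (ler_distD c _ _))// lerD2r.
exact: ler_distD.
Qed.

(** Here N and N' are the masses of two functions with values u and u' at a point.
    Moving u costs E / N, and moving the mass costs its relative change times
    u' / N', which is at most K. *)
Lemma normalized_perturb {R : realFieldType} (K u u' N N' E d c : R) :
  0 <= K -> 0 < N -> 0 < N' -> 0 <= u' <= K * N' ->
  `|u - u'| <= E -> `|N - N'| <= E + K * N * d -> N^-1 <= c ->
  `|u / N - u' / N'| <= (1 + K) * (c * E) + K * K * d.
Proof.
move=> K0 N0 N'0 /andP[u'0 u'K] uu' NN' Nc.
have -> : u / N - u' / N' = (u - u') / N - u' / N' * ((N - N') / N).
  by field; rewrite !gt_eqF.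
have E0 : 0 <= E by exact: le_trans uu'.
have h1 : `|(u - u') / N| <= c * E.
  by rewrite mulrC normrM gtr0_norm ?invr_gt0// ler_pM// invr_ge0 ltW.
have h2 : `|(N - N') / N| <= c * E + K * d.
  rewrite normrM [`|N^-1|]gtr0_norm ?invr_gt0//.
  apply: (@le_trans _ _ ((E + K * N * d) / N)).
    by rewrite ler_pM2r ?invr_gt0.
  rewrite mulrDl; apply: lerD; first by rewrite mulrC ler_wpM2r.
  by rewrite mulrAC mulfK// gt_eqF.
have q0 : 0 <= u' / N' by rewrite divr_ge0// ltW.
have qK : u' / N' <= K by rewrite ler_pdivrMr.
apply: le_trans (ler_normB _ _) _.
apply: (@le_trans _ _ (c * E + K * (c * E + K * d))).
  by apply: lerD => //; rewrite normrM ger0_norm// ler_pM.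
by suff -> : c * E + K * (c * E + K * d) = (1 + K) * (c * E) + K * K * d by []; ring.
Qed.

Lemma absz_succ n : (`|int_succ n| <= `|n|.+1)%N.
Proof. by rewrite /int_succ; lia. Qed.

Section holder_density.
Context {R : realType}.
Variables (X : int -> compactMetricType R) (Lam : forall n, set (cfun (X n))).
Arguments Lam : clear implicits.
Variables (kappa Delta : R) (tau : nat).
Hypotheses (kappa_ge1 : 1 <= kappa) (Delta_gt0 : 0 < Delta).
Local Notation block := tau.+1.
Local Notation D := (distortion Delta).
Local Notation rate := (rate Delta).
Local Notation scale := (scale kappa Delta tau).
Local Notation growth := (growth kappa tau).
Local Notation K := (harnack kappa Delta tau).
Local Notation modulus_at n := (measure_modulus (modulus := absz) kappa Delta tau n).

Let kappa_gt0 : 0 < kappa. Proof. exact: lt_le_trans kappa_ge1. Qed.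
Let D_ge0 : 0 <= D.
Proof. by rewrite ltW// (lt_trans ltr01)// distortion_gt1. Qed.
Let rate_ge0 : 0 <= rate. Proof. by rewrite ltW// rate_gt0. Qed.
Let K_gt0 : 0 < K. Proof. exact: harnack_gt0. Qed.

Section two_sequences.
Variables L L' : opseq int_succ X.
Hypothesis L_adm : admissible Lam kappa Delta tau L.
Hypothesis L'_adm : admissible Lam kappa Delta tau L'.
Variable j : nat.
Hypothesis L_L'_close : (opdist absz Lam L L' <= (scale ^+ j)%:E)%E.

Let scale_ge0 : 0 <= scale.
Proof. by have /andP[/ltW] := scale_bounds tau kappa_ge1 Delta_gt0. Qed.

Lemma pushed_close k (n : int) :
  `|@pushed R X L k n cfun1 - @pushed R X L' k n cfun1| <=
    2 ^+ (`|n| + k) * (4 * kappa) ^+ k * scale ^+ j.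
Proof.
refine (@cfun_cast_ind2 R X (fun m (f g : cfun (X m)) => `|f - g| <= _) _ _ _ _ _ _).
apply: le_trans (opprod_close absz_succ kappa_ge1 L_adm L'_adm
  (exprn_ge0 j scale_ge0) L_L'_close k (cone1 L_adm _)) _.
rewrite norm_cfun1 mulr1; apply: ler_wpM2r; first exact: exprn_ge0.
apply: ler_wpM2r; first by rewrite exprn_ge0// mulr_ge0// ltW.
by rewrite ler_weXn2l ?ler1n// advance_subK; lia.
Qed.

(** First the measure changes with u fixed, then u changes. *)
Lemma mass_close n (u u' : cfun (X n)) E M : Lam n u -> `|u - u'| <= E ->
  `|u| <= M -> `|mass L u - mass L' u'| <= E + M * (modulus_at n * rate ^+ j).
Proof.
move=> nu uu' uM; rewrite /mass.
have fin := lim_m_fin_pos kappa_ge1 Delta_gt0 L'_adm n.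
have h1 : `|pairing u (lim_m L n) - pairing u (lim_m L' n)| <=
    M * (modulus_at n * rate ^+ j).
  have H := lim_m_scale absz_succ kappa_ge1 Delta_gt0 L_adm L'_adm L_L'_close nu.
  apply: le_trans H _.
  rewrite -mulrA; apply: ler_wpM2r => //.
  by rewrite mulr_ge0 ?exprn_ge0// measure_modulus_ge0.
have h2 : `|pairing u (lim_m L' n) - pairing u' (lim_m L' n)| <= E.
  rewrite -pairingB//; have H := lim_m_norm kappa_ge1 Delta_gt0 L'_adm (u - u').
  exact: le_trans H uu'.
move: h1 h2.
move: (pairing u (lim_m L n)) (pairing u (lim_m L' n)) (pairing u' (lim_m L' n)).
move=> p q r pq qr.
have H := ler_distD q p r.
apply: (le_trans H).
rewrite addrC.
exact: lerD.
Qed.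

Lemma normalized_close_ops k n (u u' : cfun (X n)) E c : (block <= k)%N ->
  past Lam L k u -> past Lam L' k u' -> `|u - u'| <= E -> (mass L u)^-1 <= c ->
  `|normalized L u - normalized L' u'| <=
    (1 + K) * (c * E) + K * K * (modulus_at n * rate ^+ j).
Proof.
move=> bk ku ku' uu' Nc.
have N0 := past_mass_gt0 kappa_ge1 Delta_gt0 L_adm bk ku.
have N'0 := past_mass_gt0 kappa_ge1 Delta_gt0 L'_adm bk ku'.
have uK : `|u| <= K * mass L u.
  apply: cfun_norm_le => x.
  rewrite ger0_norm ?(cone_ge0 L_adm (past_cone L_adm ku))//.
  exact: past_le_mass kappa_ge1 Delta_gt0 L_adm _ _ bk _ _ ku.
have NN' := mass_close (past_cone L_adm ku) uu' uK.
apply: cfun_norm_le => x.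
have -> : (normalized L u - normalized L' u') x = u x / mass L u - u' x / mass L' u'.
  rewrite (mulrC (u x)) (mulrC (u' x)).
  exact: erefl.
apply: normalized_perturb (ltW K_gt0) N0 N'0 _ _ NN' Nc.
  rewrite (cone_ge0 L'_adm (past_cone L'_adm ku'))/=.
  exact: past_le_mass kappa_ge1 Delta_gt0 L'_adm _ _ bk _ _ ku'.
by apply: le_trans uu'; exact: (cfun_norm_ub (u - u')).
Qed.

(** Both densities are approximated by the normalized image of the constant 1
    from j + 1 blocks in the past, at the same rate. *)
Lemma lim_h_scale n : `|lim_h Lam L n - lim_h Lam L' n| <=
  (2 * (K * D) + (1 + K) * (2 ^+ `|n| * growth) + K * K * modulus_at n) * rate ^+ j.
Proof.
have [k kE] : exists k, k = (j.+1 * block)%N by exists (j.+1 * block)%N.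
have bk : (block <= k)%N by rewrite kE leq_pmull.
have jk : (j.+1 * block <= k)%N by rewrite kE.
have [E EE] : exists E, E = 2 ^+ (`|n| + k) * (4 * kappa) ^+ k * scale ^+ j by eexists.
have cE : kappa ^+ k * E <= 2 ^+ `|n| * growth * rate ^+ j.
  have G := @growth_scale R kappa Delta tau kappa_ge1 j.
  rewrite -[leRHS]mulrA -G -kE EE exprD.
  have -> : (8 * kappa ^+ 2) ^+ k = 2 ^+ k * (4 * kappa) ^+ k * kappa ^+ k.
    by rewrite -!exprMn; congr (_ ^+ _); ring.
  by rewrite le_eqVlt; apply/orP; left; apply/eqP; ring.
have uu' := pushed_close k n; rewrite -EE in uu'.
have Nc := mass_pushed1_inv kappa_ge1 Delta_gt0 L_adm k n.
have ku : past Lam L k (@pushed R X L k n cfun1).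
  by exists cfun1 => //; exact: cone1 L_adm _.
have ku' : past Lam L' k (@pushed R X L' k n cfun1).
  by exists cfun1 => //; exact: cone1 L'_adm _.
move: (@pushed R X L k n cfun1) (@pushed R X L' k n cfun1) ku ku' uu' Nc.
move=> u u' ku ku' uu' Nc.
have hu := is_h_close kappa_ge1 Delta_gt0 L_adm
  (@lim_hP _ _ _ _ _ _ _ kappa_ge1 Delta_gt0 L_adm n) jk ku.
have hu' := is_h_close kappa_ge1 Delta_gt0 L'_adm
  (@lim_hP _ _ _ _ _ _ _ kappa_ge1 Delta_gt0 L'_adm n) jk ku'.
have uu'N : `|normalized L u - normalized L' u'| <=
    ((1 + K) * (2 ^+ `|n| * growth) + K * K * modulus_at n) * rate ^+ j.
  apply: le_trans (normalized_close_ops bk ku ku' uu' Nc) _.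
  rewrite [leRHS]mulrDl [X in _ <= _ + X]mulrAC -!mulrA [rate ^+ j * _]mulrC.
  apply: lerD => //; apply: ler_wpM2l; first by rewrite addr_ge0// ltW.
  by rewrite mulrA.
have H := ler_dist3 (lim_h Lam L n) (normalized L u) (normalized L' u') (lim_h Lam L' n).
apply: (le_trans H); apply: (le_trans (lerD (lerD hu uu'N) hu')).
rewrite -!mulrDl; apply: ler_wpM2r; first exact: exprn_ge0.
move: (K * D) (_ * (_ * growth)) (K * K * _) => p q r.
suff -> : p + (q + r) + p = 2 * p + q + r by [].
ring.
Qed.

End two_sequences.

Lemma lim_h_locally_holder n :
  locally_holder (admissible Lam kappa Delta tau) (opdist absz Lam)
    (fun L : opseq int_succ X => lim_h Lam L n).
Proof.
set C := 2 * (K * D) + (1 + K) * (2 ^+ `|n| * growth) + K * K * modulus_at n.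
have C0 : 0 <= C.
  have g0 : 0 <= growth by rewrite (le_trans ler01)// growth_ge1.
  rewrite /C; apply: addr_ge0; first apply: addr_ge0.
  - by apply: mulr_ge0 => //; apply: mulr_ge0 => //; exact: ltW.
  - apply: mulr_ge0; first by apply: addr_ge0 => //; exact: ltW.
    by apply: mulr_ge0 => //; exact: exprn_ge0.
  - apply: mulr_ge0; first by apply: mulr_ge0; exact: ltW.
    exact: measure_modulus_ge0.
pose B := 2 * (K * D + K).
have B0 : 0 <= B.
  apply: mulr_ge0 => //; apply: addr_ge0; last exact: ltW.
  by apply: mulr_ge0 => //; exact: ltW.
apply: (@locally_holder_of_scales _ _ _ _ _ _ rate scale (C + B)) => //.
- exact: rate_bounds.
- exact: scale_bounds.
- exact: addr_ge0.
- by move=> y z yA _; exact: opdist_ge0 yA.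
- move=> y z yA zA; rewrite (le_trans (ler_normB _ _))//.
  apply: (@le_trans _ _ B); last by rewrite lerDr.
  rewrite /B mulr_natl mulr2n; apply: lerD.
    exact: lim_h_norm kappa_ge1 Delta_gt0 yA _.
  exact: lim_h_norm kappa_ge1 Delta_gt0 zA _.
- move=> j y z yA zA yz; apply: le_trans (lim_h_scale yA zA yz n) _.
  by apply: ler_wpM2r; [exact: exprn_ge0|rewrite lerDl].
Qed.

End holder_density.

Unset Implicit Arguments.

Theorem theorem2p8 (R : realType) (X : int -> compactMetricType R)
  (Lam : forall n : int, set (cfun (X n)))
  (kappa Delta : R) (tau : nat)
  (hLam : forall n : int,
     closed_convex_cone (Lam n) /\ Lam n `<=` cfun_pos (X n))
  (hkappa : 1 <= kappa) (hDelta : 0 < Delta) :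
  [/\
    (forall L, L0plus Lam kappa Delta tau L -> 0 < lim_lambda L 0%N) /\
    locally_holder (L0plus Lam kappa Delta tau) (dist1 Lam)
      (fun L => lim_lambda L 0%N),

    forall f : cfun (X 0), Lam 0 f ->
      locally_holder (L0plus Lam kappa Delta tau) (dist1 Lam)
        (fun L => pairing f (lim_m L 0%N)),

    locally_holder (L0 Lam kappa Delta tau) (dist2 Lam)
      (fun L => lim_h Lam L 0),

    forall n : nat,
      locally_holder (L0plus Lam kappa Delta tau) (dist1 Lam)
        (fun L => lim_lambda L n) /\
      (forall f : cfun (X n%:Z), Lam n%:Z f ->
         locally_holder (L0plus Lam kappa Delta tau) (dist1 Lam)
           (fun L => pairing f (lim_m L n))) &

    forall n : int,
      [/\ locally_holder (L0 Lam kappa Delta tau) (dist2 Lam)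
            (fun L => lim_lambda L n),
          forall f : cfun (X n), Lam n f ->
            locally_holder (L0 Lam kappa Delta tau) (dist2 Lam)
              (fun L => pairing f (lim_m L n)) &
          locally_holder (L0 Lam kappa Delta tau) (dist2 Lam)
            (fun L => lim_h Lam L n)]].
Proof.
have fwd_modulus n : (id n.+1 <= (id n).+1)%N by [].
have lambda_fwd n : locally_holder (L0plus Lam kappa Delta tau) (dist1 Lam)
    (fun L => lim_lambda L n).
  have H := @lim_lambda_locally_holder R nat S id fwd_modulus (spaces_fwd X)
    (cones_fwd Lam) kappa Delta tau hkappa hDelta n.
  exact H.
have m_fwd (n : nat) (f : cfun (X n%:Z)) : Lam n%:Z f ->
    locally_holder (L0plus Lam kappa Delta tau) (dist1 Lam)
      (fun L => pairing f (lim_m L n)).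
  move=> nf; have H := @lim_m_locally_holder R nat S id fwd_modulus (spaces_fwd X)
    (cones_fwd Lam) kappa Delta tau hkappa hDelta n f nf.
  exact H.
split.
- split; last exact: lambda_fwd.
  by move=> L L_adm; exact: lim_lambda_gt0 hkappa hDelta L_adm _.
- by move=> f; exact: (m_fwd 0%N).
- exact: lim_h_locally_holder.
- by move=> n; split; [exact: lambda_fwd|exact: m_fwd].
- move=> n; split.
  + have H := @lim_lambda_locally_holder R int int_succ absz absz_succ X Lam
      kappa Delta tau hkappa hDelta n.
    exact H.
  + move=> f nf; have H := @lim_m_locally_holder R int int_succ absz absz_succ X Lam
      kappa Delta tau hkappa hDelta n f nf.
    exact H.
  + exact: lim_h_locally_holder.
Qed.
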